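(* Let $d\ge 2$ and let $P$ be a simple $d$-polytope in $\mathbb{R}^d$. Then $s(d,P)=d$. Furthermore, assume that $P$ has $m$ facets and is given by $m$ affine inequalities $q_1(x)\ge 0,\ldots,q_m(x)\ge 0$, i.e. $P=\{x\in\mathbb{R}^d : q_j(x)\ge 0 \text{ for } 1\le j\le m\}$ with affine functions $q_1,\ldots,q_m$ on $\mathbb{R}^d$. For $1\le i\le d-1$ put $$p_i(x):=\sigma_{m-d+i+1}(q_1(x),\ldots,q_m(x))$$ (so that $p_{d-1}=\sigma_m(q_1,\ldots,q_m)$ and $p_1=\sigma_{m-d+2}(q_1,\ldots,q_m)$). Then there exist $k\in\mathbb{N}$, scalars $y_v>0$ for $v\in\mathrm{vert}(P)$, and scalars $\lambda_j>0$ for $1\le j\le m$ such that, with $$p_0(x):=1-\sum_{v\in\mathrm{vert}(P)} y_v\left(\frac1d\sum_{\substack{j=1,\ldots,m\\ q_j(v)=0}}\bigl(1-\lambda_j q_j(x)\bigr)^{2k}\right)^{2k},$$ one has $$P=\{x\in\mathbb{R}^d : p_i(x)\ge 0 \text{ for } 0\le i\le d-1\}.$$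
   Context: A $d$-polytope is a bounded convex polyhedron of dimension $d$. It is called simple if each of its vertices is contained in precisely $d$ facets. $\mathrm{vert}(P)$ is the set of vertices of $P$. For a $d$-polytope $P\subseteq\mathbb{R}^d$, $s(d,P)$ denotes the least cardinality of a finite set $\mathcal{P}$ of real polynomials in $x\in\mathbb{R}^d$ such that $P=\{x\in\mathbb{R}^d : p(x)\ge 0 \text{ for all } p\in\mathcal{P}\}$. The elementary symmetric polynomials are $\sigma_l(y_1,\ldots,y_m):=\sum_{J\subseteq\{1,\ldots,m\},\,\#J=l}\prod_{j\in J}y_j$, with $\sigma_0:=1$ and $\sigma_l:=0$ for $l<0$ or $l>m$. $\mathbb{N}$ is the set of positive integers. *)

(* Defs.v *)
From HB Require Import structures.
From mathcomp Require Import all_boot all_order all_algebra finmap.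
From mathcomp Require Import all_classical all_reals topology normedtype.
(* The notations of mpoly clash with those of MathComp-Analysis. *)
From mathcomp Require Import -(notations) mpoly.

Set Implicit Arguments.
Unset Strict Implicit.
Unset Printing Implicit Defensive.

Import Order.TTheory GRing.Theory Num.Theory numFieldNormedType.Exports.
Local Open Scope classical_set_scope.
Local Open Scope ring_scope.

Definition affine_fun (R : realType) (d : nat) (h : 'rV[R]_d -> R) : Prop :=
  exists (l : {scalar 'rV[R]_d}) (b : R), forall x, h x = l x + b.

Definition polyhedron (R : realType) (d : nat) (P : set 'rV[R]_d) : Prop :=
  exists (n : nat) (h : 'I_n -> 'rV[R]_d -> R),
    (forall j, affine_fun (h j)) /\ P = [set x | forall j, 0 <= h j x].

(* The dimension of the affine hull x0 + U of S; no k qualifies if S is empty. *)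
Definition has_dim (R : realType) (d : nat) (S : set 'rV[R]_d) (k : nat) : Prop :=
  exists (x0 : 'rV[R]_d) (U : {vspace 'rV[R]_d}),
    [/\ S x0,
        forall x, S x -> x - x0 \in U,
        forall V : {vspace 'rV[R]_d},
          (forall x, S x -> x - x0 \in V) -> (U <= V)%VS
      & \dim U = k].

(* A d-polytope in R^d, d being the dimension of the ambient space. *)
Definition full_polytope (R : realType) (d : nat) (P : set 'rV[R]_d) : Prop :=
  [/\ polyhedron P, bounded_set P & has_dim P d].

(* Faces cut out by valid affine inequalities; the constant functions 0 and 1
   yield the improper faces P and set0. *)
Definition face (R : realType) (d : nat) (P F : set 'rV[R]_d) : Prop :=
  exists h : 'rV[R]_d -> R,
    [/\ affine_fun h, forall x, P x -> 0 <= h x & F = P `&` [set x | h x = 0]].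

(* The facets of a d-polytope in R^d. *)
Definition facets (R : realType) (d : nat) (P : set 'rV[R]_d) :
    set (set 'rV[R]_d) :=
  [set F | face P F /\ has_dim F d.-1].

Definition vert (R : realType) (d : nat) (P : set 'rV[R]_d) : set 'rV[R]_d :=
  [set v | face P [set v]].

Definition simple_polytope (R : realType) (d : nat) (P : set 'rV[R]_d) : Prop :=
  full_polytope P /\
  forall v, vert P v -> ([set F | facets P F /\ F v] #= `I_d)%card.

Definition represents (R : realType) (d : nat)
    (A : {fset mpoly d R}) (P : set 'rV[R]_d) : Prop :=
  P = [set x | forall p, p \in A -> 0 <= meval (x ord0) p].

(* s(d, P), with the convention that it is 0 if P has no finite representation. *)
Definition s_min (R : realType) (d : nat) (P : set 'rV[R]_d) : nat :=
  xget 0%N [set n | (exists A, represents A P /\ #|` A|%fset = n) /\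
                    (forall A, represents A P -> (n <= #|` A|%fset)%N)].

(* sigma_l(q_1(x), ..., q_m(x)) *)
Definition sigma_at (R : realType) (d m : nat) (q : 'I_m -> 'rV[R]_d -> R)
    (l : nat) (x : 'rV[R]_d) : R :=
  meval (fun j => q j x) (mesym m R l).

(* The difference m - d is truncated, but a d-polytope has m > d facets. *)
Definition p_sym (R : realType) (d m : nat) (q : 'I_m -> 'rV[R]_d -> R)
    (i : nat) (x : 'rV[R]_d) : R :=
  sigma_at q (m - d + i + 1) x.

(* A finitely supported sum over vert P, which is a finite set if P is a
   polyhedron. *)
Definition p_zero (R : realType) (d m : nat) (P : set 'rV[R]_d)
    (q : 'I_m -> 'rV[R]_d -> R) (k : nat) (y : 'rV[R]_d -> R)
    (lambda : 'I_m -> R) (x : 'rV[R]_d) : R :=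
  1 - \sum_(v \in vert P)
        y v * (d%:R^-1 * \sum_(j < m | q j v == 0)
                            (1 - lambda j * q j x) ^+ (2 * k)) ^+ (2 * k).

(* Main.v *)
Require Import Defs.
From HB Require Import structures.
From mathcomp Require Import all_boot all_order all_algebra finmap.
From mathcomp Require Import all_classical all_reals topology normedtype.
From mathcomp Require Import sequences derive.
From mathcomp Require Import ring lra zify.
(* The notations of mpoly clash with those of topology and normedtype. *)
From mathcomp Require Import -(notations) mpoly.

(** Write q_1, ..., q_m for the affine functions of the facets and sigma_l for the
elementary symmetric sums of the values q_j(x).

Description of P by d polynomials.  The identity
prod_j (1 + t q_j) = sum_l sigma_l t^l shows that all q_j are nonnegative as
soon as all sigma_l are: the left side vanishes at a positive t if some q_j is
negative, and the right side does not (sym_sum_ge0).  Let z be a point of P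
lying on r facets.  Then sigma_l(z) > 0 for l <= m - r, and this persists near
z.  If z is not a vertex, then r < d, so that the remaining sigma_l are among
p_1, ..., p_(d-1): near z these polynomials alone cut out P (near_nonvertex).
At a vertex v one has r = d and only sigma_(m-d+1) is not controlled.  Let
e_1, e_2 be the first two symmetric sums of the d functions y_j that vanish at
v, and B > 0 the product of the other ones.  To leading order sigma_(m-d+2) is
B e_2 and sigma_(m-d+1) is B e_1.  Since e_1^2 = sum y_j^2 + 2 e_2, the
condition sigma_(m-d+2) >= 0 confines y to a double cone around the diagonal,
on which |e_1| is comparable to |y|.  So an inequality e_1 >= - c |y| with a
small c selects the half where e_1 > 0, and there sigma_(m-d+1) >= 0
(sym_sum_near_vertex, near_vertex).

The polynomial p_0 provides this inequality at every vertex.  All lambda_j are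
taken equal to one small constant lambda.  The terms belonging to w in p_0 are
1 at w and decay exponentially in k at the other vertices, so a diagonally
dominant linear system gives weights y_w close to 1 for which p_0 vanishes at
every vertex.  As 1 - p_0 is convex and P is the convex hull of its vertices,
p_0 >= 0 on P (potential_le1).  Conversely, the convexity of 1 - p_0 bounds p_0
by its linearization at v, whose slope is, up to a positive factor,
sum_(q_j(v) = 0) q_j with an exponentially small error; so p_0 >= 0
yields the required inequality (potential_tangent).  Moreover p_0 >= 0 forces
(1 - lambda q_j)^(2k) <= 2d, hence q_j >= - eps for k large
(polytope_approximation).  The neighbourhoods of the points of P do not depend
on k, so that compactness lets a single k serve for all of them
(near_polytope).

Fewer than d polynomials do not suffice.  At a vertex v the d vanishing q_j are
affine coordinates; let L_i be the common zero set of the first i of them.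
In any representation of P and for every i < d some polynomial vanishes on
L_(i+1) but not on L_i.  Otherwise one starts at a point of P in L_(i+1) where
all polynomials that do not vanish identically on L_(i+1) are positive, and
leaves P inside L_i without making any polynomial negative (flag_step).  The d
polynomials so obtained are pairwise distinct (represents_card). *)

Set Implicit Arguments.
Unset Strict Implicit.
Unset Printing Implicit Defensive.

Import Order.TTheory GRing.Theory Num.Theory numFieldNormedType.Exports.
Local Open Scope classical_set_scope.
Local Open Scope ring_scope.

(** * Elementary symmetric sums through their generating polynomial *)

Section SymmetricSums.
Variable R : realFieldType.

Definition sym_sum (I : finType) (y : I -> R) (l : nat) : R :=
  \sum_(h : {set I} | #|h| == l) \prod_(i in h) y i.

Definition gen_poly (I : finType) (A : {set I}) (y : I -> R) : {poly R} :=
  \prod_(i in A) (1 + y i *: 'X).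

Lemma coef_gen_poly (I : finType) (y : I -> R) l :
  (gen_poly [set: I] y)`_l = sym_sum y l.
Proof.
rewrite /gen_poly (eq_bigl xpredT); last by move=> i; rewrite inE.
under eq_bigr do rewrite addrC.
rewrite bigA_distr /= coef_sum /sym_sum [RHS]big_mkcond /=.
apply: eq_bigr => h _; rewrite -big_mkcond /=.
have -> : \prod_(i in h) (y i *: 'X) = (\prod_(i in h) y i) *: 'X^#|h| :> {poly R}.
  rewrite scaler_prod; congr (_ *: _).
  by rewrite prodr_const.
by rewrite coefZ coefXn eq_sym; case: eqP; rewrite ?mulr1 ?mulr0.
Qed.

(** The generating polynomial has nonnegative coefficients and constant term 1,
    so it has no positive root; a negative value y_j gives the root - 1 / y_j. *)
Lemma sym_sum_ge0 (I : finType) (y : I -> R) :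
  (forall l, (l <= #|I|)%N -> 0 <= sym_sum y l) -> forall j, 0 <= y j.
Proof.
move=> H j; case: leP => // yj.
have sz : (size (gen_poly [set: I] y) <= #|I|.+1)%N.
  apply/leq_sizeP => l Il; rewrite coef_gen_poly /sym_sum big1 // => h /eqP hl.
  by have := max_card (mem h); rewrite hl leqNgt Il.
have t0 : 0 < - (y j)^-1 by rewrite oppr_gt0 invr_lt0.
have : (gen_poly [set: I] y).[- (y j)^-1] = 0.
  rewrite /gen_poly (bigD1 j) ?inE //= hornerM hornerD hornerZ hornerX hornerC.
  by rewrite mulrN divff ?lt_eqF // subrr mul0r.
rewrite (horner_coef_wide _ sz) big_ord_recl expr0 mulr1 coef_gen_poly.
have -> : sym_sum y 0 = 1.
  rewrite /sym_sum (big_pred1 finset.set0); first by rewrite big_set0.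
  by move=> h /=; rewrite cards_eq0.
move/eqP; rewrite gt_eqF //. rewrite ltr_pwDl //; apply: sumr_ge0 => i _.
rewrite mulr_ge0 ?exprn_ge0 ?(ltW t0) // coef_gen_poly H //.
by rewrite lift0 ltn_ord.
Qed.

Lemma gen_polyE (I : finType) (A : {set I}) y :
  gen_poly A y = \prod_(i <- enum A) (1 + y i *: 'X).
Proof. by rewrite /gen_poly big_enum. Qed.

(** The recursion behind every statement on the coefficients of a generating
    polynomial. *)
Lemma coef_gen_step (c : R) (g : {poly R}) i :
  ((1 + c *: 'X) * g)`_i = g`_i + c * (if i is i'.+1 then g`_i' else 0).
Proof.
rewrite mulrDl mul1r coefD -scalerAl coefZ coefXM.
by case: i.
Qed.

(** The last clause is Newton's identity between e_1, e_2 and the sum of the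
    squares. *)
Lemma gen_poly_coef012 (I : finType) (A : {set I}) (y : I -> R) :
  [/\ (gen_poly A y)`_0 = 1, (gen_poly A y)`_1 = \sum_(i in A) y i &
    (\sum_(i in A) y i) ^+ 2 = \sum_(i in A) y i ^+ 2 + 2 * (gen_poly A y)`_2].
Proof.
have sumE f : \sum_(i in A) f i = \sum_(i <- enum A) f i :> R by rewrite big_enum.
rewrite gen_polyE !sumE.
elim: (enum A) => [|a s [IH0 IH1 IH2]].
  by rewrite !big_nil !coef1 /= expr0n /= mulr0 addr0.
rewrite !big_cons !coef_gen_step IH0 IH1 mulr0 addr0 mulr1; split=> //.
  by rewrite addrC.
by rewrite sqrrD IH2; ring.
Qed.

Lemma gen_poly_coef_bound (I : finType) (A : {set I}) (y : I -> R) (M : R) i :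
  0 <= M -> (forall i, i \in A -> `|y i| <= M) ->
  `|(gen_poly A y)`_i| <= 2 ^+ #|A| * M ^+ i.
Proof.
move=> M0 yM; rewrite gen_polyE cardE.
have {yM} : forall i, i \in enum A -> `|y i| <= M.
  by move=> k; rewrite mem_enum; apply: yM.
elim: (enum A) i => [|a s IH] i yM.
  rewrite big_nil coef1; case: i => [|i] /=; first by rewrite normr1 !expr0 mul1r.
  by rewrite normr0 mul1r exprn_ge0.
have IHs k : `|(\prod_(i <- s) (1 + y i *: 'X))`_k| <= 2 ^+ size s * M ^+ k.
  by apply: IH => j js; apply: yM; rewrite inE js orbT.
rewrite big_cons coef_gen_step (le_trans (ler_normD _ _)) //.
rewrite /= exprS -mulrA mulr_natl mulr2n lerD //.
case: i => [|i]; first by rewrite mulr0 normr0 mulr_ge0 ?exprn_ge0.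
rewrite normrM exprS mulrCA ler_pM ?normr_ge0 //.
by apply: yM; rewrite inE eqxx.
Qed.

Lemma gen_poly_top (I : finType) (A : {set I}) (y : I -> R) :
  (gen_poly A y)`_#|A| = \prod_(i in A) y i /\
  forall k, (#|A| < k)%N -> (gen_poly A y)`_k = 0.
Proof.
have -> : \prod_(i in A) y i = \prod_(i <- enum A) y i by rewrite big_enum.
rewrite gen_polyE cardE.
elim: (enum A) => [|a s [IH1 IH2]].
  rewrite !big_nil coef1; split=> // k k0; rewrite coef1.
  by case: k k0.
rewrite !big_cons coef_gen_step /= IH1 IH2 // add0r; split=> // -[//|k].
by rewrite ltnS => sk; rewrite coef_gen_step !IH2 ?mulr0 ?addr0 // ltnW.
Qed.

(** The values indexed by A are at most M, and M is to be thought of as small.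
    Splitting the generating polynomial into the factors in A and those outside,
    the l-th coefficient with l = #|I| - #|A| + i has the leading term shown here,
    of order M^i; the other terms take more than i factors from A, since the
    factors outside A only reach degree #|I| - #|A|. *)
Lemma sym_sum_vertex (I : finType) (A : {set I}) (y : I -> R) (K M : R) (i : nat) :
  (1 <= K) -> 0 <= M <= 1 -> (0 < i <= #|A|)%N ->
  (forall j, j \notin A -> `|y j| <= K) ->
  (forall j, j \in A -> `|y j| <= M) ->
  `|sym_sum y (#|I| - #|A| + i) - (\prod_(j in ~: A) y j) * (gen_poly A y)`_i|
    <= #|I|%:R * (2 ^+ #|I| * (2 ^+ #|I| * K ^+ #|I|)) * M ^+ i.+1.
Proof.
move=> K1 /andP[M0 M1] /andP[i0 iA] yK yM.
have K0 : 0 <= K by lra.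
have nE : (#|I| - #|A|)%N = #|~: A| by rewrite -(cardsC A) addKn.
have IE : #|I| = (#|A| + #|~: A|)%N by rewrite cardsC.
rewrite nE -coef_gen_poly.
have -> : gen_poly [set: I] y = gen_poly A y * gen_poly (~: A) y.
  rewrite /gen_poly (eq_bigl xpredT); last by move=> k; rewrite inE.
  rewrite (bigID (mem A)) /=; congr (_ * _).
  by apply: eq_bigl => k; rewrite inE.
have [top0 top1] := gen_poly_top (~: A) y.
rewrite coefM -top0.
set n := (#|~: A| + i)%N.
have iltn : (i < n.+1)%N by rewrite ltnS leq_addl.
rewrite (bigD1 (Ordinal iltn)) //= /n addnK [_ * (gen_poly A y)`_i]mulrC addrAC subrr add0r.
rewrite (le_trans (ler_norm_sum _ _ _)) //.
have bound (k : 'I_n.+1) : k != Ordinal iltn ->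
  `|(gen_poly A y)`_k * (gen_poly (~: A) y)`_(n - k)| <=
    2 ^+ #|I| * (2 ^+ #|I| * K ^+ #|I|) * M ^+ i.+1.
  move=> ki; have [ki'|ki'] := ltnP k i.
    rewrite [X in _ * X]top1 ?mulr0 ?normr0 ?mulr_ge0 ?exprn_ge0 //.
    by rewrite /n -addnBA ?(ltnW ki') // -{1}[#|_|]addn0 ltn_add2l subn_gt0.
  have {ki ki'} ik : (i < k)%N.
    by rewrite ltn_neqAle ki' andbT; apply: contra_neq ki => ki; apply: val_inj.
  rewrite normrM (le_trans (ler_pM _ _ (gen_poly_coef_bound _ M0 yM)
    (gen_poly_coef_bound _ K0 (_ : forall j, j \in ~: A -> _)))) //.
    by move=> j; rewrite inE; apply: yK.
  have p2 (a b : nat) : (a <= b)%N -> 2 ^+ a <= 2 ^+ b :> R.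
    by move=> ab; rewrite ler_weXn2l ?ler1n.
  rewrite mulrAC ler_pM ?mulr_ge0 ?exprn_ge0 //; last first.
    by rewrite ler_wiXn2l.
  rewrite ler_pM ?mulr_ge0 ?exprn_ge0 //; first by rewrite p2 // IE leq_addr.
  rewrite ler_pM ?mulr_ge0 ?exprn_ge0 //; first by rewrite p2 // IE leq_addl.
  rewrite ler_weXn2l // (leq_trans (leq_subr _ _)) // IE.
  by rewrite /n addnC leq_add2r.
rewrite (le_trans (ler_sum _ bound)) //.
rewrite (eq_bigl (mem (predC1 (Ordinal iltn)))); last by move=> k; rewrite !inE.
rewrite sumr_const cardC1 card_ord -[leLHS]mulr_natl -[leRHS]mulrA.
rewrite ler_wpM2r ?mulr_ge0 ?exprn_ge0 //.
by rewrite ler_nat /= IE [leqRHS]addnC leq_add2l.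
Qed.
 
(** The hypothesis on the second sum says that e_2 is at least of the order
    - M^3, so that e_1^2 = sum y_j^2 + 2 e_2 is at least M^2 / 2.  As e_1 is at
    least - M / 4, it must be at least M / 2, and then it dominates the error of
    order M^2 in the first sum. *)
Lemma sym_sum_near_vertex (I : finType) (A : {set I}) (beta K : R) :
  (2 <= #|A|)%N -> 0 < beta -> 1 <= K ->
  exists2 M0 : R, 0 < M0 &
  forall (y : I -> R) (M : R),
    M <= M0 ->
    (forall j, j \notin A -> `|y j| <= K) ->
    beta <= \prod_(j in ~: A) y j ->
    (forall j, j \in A -> `|y j| <= M) ->
    (exists2 j, j \in A & `|y j| = M) ->
    - (M / 4) <= \sum_(j in A) y j ->
    0 <= sym_sum y (#|I| - #|A| + 2) ->
    0 <= sym_sum y (#|I| - #|A| + 1).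
Proof.
move=> A2 b0 K1.
(* The error constant of sym_sum_vertex. *)
pose C : R := #|I|%:R * (2 ^+ #|I| * (2 ^+ #|I| * K ^+ #|I|)).
have C0 : 0 <= C by rewrite !mulr_ge0 ?exprn_ge0 //; lra.
(* With this bound C M^2 <= beta M / 4 and C M^3 <= beta M^2 / 4. *)
exists (Num.min 1 (beta / (4 * (C + 1)))).
  by rewrite lt_min ltr01 divr_gt0 //; lra.
move=> y M; rewrite le_min ler_pdivlMr; last lra.
move=> /andP[M1 MC] yK yb yM [j0 j0A j0M] S1 s2.
have M0 : 0 <= M by rewrite -j0M.
have [] := gen_poly_coef012 A y.
have B1 := sym_sum_vertex (i := 1) K1 _ _ yK yM.
have B2 := sym_sum_vertex (i := 2) K1 _ _ yK yM.
move: B1 B2; rewrite -/C M0 M1 A2 (ltnW A2) /= => /(_ isT isT) + /(_ isT isT).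
set B := \prod_(j in _) _; rewrite -/B in yb *.
set g1 := (gen_poly A y)`_1; set g2 := (gen_poly A y)`_2.
set s := \sum_(j in A) _ in S1 *; set s1 := sym_sum y _; set s2' := sym_sum y _ in s2 *.
rewrite !ler_norml => /andP[B1 _] /andP[_ B2] _ g1s sq.
have q0 : M ^+ 2 <= \sum_(i in A) y i ^+ 2.
  rewrite (bigD1 j0) //= -j0M real_normK ?num_real // lerDl sumr_ge0 // => i _.
  exact: sqr_ge0.
have CM1 : C * M ^+ 2 <= beta * M / 4.
  have : M * (4 * (C + 1) * M) <= M * beta by rewrite ler_wpM2l // mulrC.
  nra.
have CM2 : C * M ^+ 3 <= beta * M ^+ 2 / 4.
  have : M * (C * M ^+ 2) <= M * (beta * M / 4) by rewrite ler_wpM2l.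
  by rewrite exprS; nra.
have g2b : - (M ^+ 2 / 4) <= g2.
  case: (lerP 0 g2) => g20; first by have := sqr_ge0 M; lra.
  have : B * g2 <= beta * g2 by rewrite ler_wnM2r // ltW.
  move=> h; have : - (beta * M ^+ 2 / 4) <= beta * g2 by lra.
  rewrite -mulrA -mulrN ler_pM2l //.
have s4 : M / 2 <= s.
  rewrite leNgt; apply/negP => sM.
  have : (s + M / 4) * (M / 2 - s) >= 0 by rewrite mulr_ge0; lra.
  have : M * (M / 2 - s) >= 0 by rewrite mulr_ge0; lra.
  have : 0 < M by lra.
  nra.
have : beta * s <= B * s by rewrite ler_wpM2r //; lra.
have : beta * (M / 2) <= beta * s by rewrite ler_wpM2l // ltW.
rewrite g1s in B1.
have : 0 <= beta * M by rewrite mulr_ge0 // ltW.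
lra.
Qed.

(** The graph of an even power lies above its tangent at c. *)
Lemma bernoulli_tangent (k : nat) (a c : R) :
  c ^+ (2 * k) + (2 * k)%:R * c ^+ (2 * k).-1 * (a - c) <= a ^+ (2 * k).
Proof.
have pos (n : nat) (u v : R) : 0 <= u -> 0 <= v ->
    v ^+ n + n%:R * v ^+ n.-1 * (u - v) <= u ^+ n.
  move=> u0 v0; elim: n => [|n IH]; first by rewrite !expr0 mul0r mul0r addr0.
  case: n IH => [|n] IH; first by rewrite !expr1 expr0 /=; lra.
  have := ler_wpM2l u0 IH; rewrite -exprS; apply: le_trans.
  rewrite /= !exprS -subr_ge0.
  set X := v ^+ n.
  have -> : u * (v * X + n.+1%:R * X * (u - v)) -
     (v * (v * X) + n.+2%:R * (v * X) * (u - v)) = n.+1%:R * X * (u - v) ^+ 2.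
    by rewrite -[in n.+2%:R]addn1 natrD; ring.
  by rewrite mulr_ge0 ?sqr_ge0 // mulr_ge0 // exprn_ge0.
case: k => [|k]; first by rewrite !muln0 !expr0 mul0r mul0r addr0.
have e2 (b : R) : b ^+ (2 * k.+1) = `|b| ^+ (2 * k.+1).
  by rewrite !exprM real_normK ?num_real.
rewrite e2 [a ^+ _]e2; apply: le_trans (pos _ _ _ (normr_ge0 a) (normr_ge0 c)).
rewrite lerD2l -!mulrA ler_wpM2l // !mulrBr.
have e3 (b : R) : b ^+ (2 * k.+1).-1 * b = b ^+ (2 * k.+1).
  by rewrite -exprSr prednK // muln_gt0.
rewrite !e3 -e2 lerD2r -normrX -normrM ler_norm //.
Qed.

Lemma even_exp_convex (k : nat) (s a b : R) :
  0 <= s <= 1 ->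
  (s * a + (1 - s) * b) ^+ (2 * k) <= s * a ^+ (2 * k) + (1 - s) * b ^+ (2 * k).
Proof.
move=> /andP[s0 s1]; set c := s * a + _.
have s1' : 0 <= 1 - s by lra.
have := ler_wpM2l s0 (bernoulli_tangent k a c).
have := ler_wpM2l s1' (bernoulli_tangent k b c).
set D := _ * c ^+ _.-1; set X := c ^+ _ => h1 h2.
have : s * (D * (a - c)) + (1 - s) * (D * (b - c)) = 0 by rewrite /c; ring.
lra.
Qed.

End SymmetricSums.

(** * Affine functions *)

Section Affine.
Variables (R : realType) (d : nat).
Implicit Types (h : 'rV[R]_d -> R) (x u : 'rV[R]_d).

(** The linear part of an affine function. *)
Definition slope h u : R := h u - h 0.

Lemma slope_scalar h : affine_fun h -> exists l : {scalar 'rV[R]_d}, slope h =1 l.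
Proof.
by move=> [l [b hE]]; exists l => u; rewrite /slope !hE linear0 add0r addrK.
Qed.

Lemma slopeZ h a u : affine_fun h -> slope h (a *: u) = a * slope h u.
Proof. by move=> /slope_scalar[l lE]; rewrite !lE linearZ. Qed.

Lemma slopeN h u : affine_fun h -> slope h (- u) = - slope h u.
Proof. by move=> /slope_scalar[l lE]; rewrite !lE linearN. Qed.

Lemma affine_slope h x u : affine_fun h -> h (x + u) = h x + slope h u.
Proof. by move=> [l [b hE]]; rewrite /slope !hE !linearD linear0 /=; lra. Qed.

Lemma affine_ray h x u t : affine_fun h -> h (x + t *: u) = h x + t * slope h u.
Proof. by move=> ha; rewrite affine_slope // slopeZ. Qed.

Lemma affine_comb h s a b : affine_fun h ->
  h (s *: a + (1 - s) *: b) = s * h a + (1 - s) * h b.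
Proof.
by move=> [l [c hE]]; rewrite !hE linearD !linearZ /=; ring.
Qed.

Lemma affine_sub h x y : affine_fun h -> slope h (x - y) = h x - h y.
Proof. by move=> ha; have := affine_slope y (x - y) ha; rewrite addrC subrK => ->; lra. Qed.

Lemma affine_coef h x : affine_fun h -> h x = h 0 + \sum_i x 0 i * slope h (delta_mx 0 i).
Proof.
move=> ha; have [l lE] := slope_scalar ha.
have -> : h x = h 0 + l x by rewrite -lE addrC subrK.
congr (_ + _).
rewrite {1}(row_sum_delta x) linear_sum /=; apply: eq_bigr => i _.
by rewrite lE linearZ.
Qed.

Lemma affine_continuous h : affine_fun h -> continuous h.
Proof.
move=> ha; have -> : h = fun x => h 0 + \sum_i x 0 i * slope h (delta_mx 0 i).
  by apply/funext => x; apply: affine_coef.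
have C : continuous (fun x : 'rV[R]_d => \sum_i x 0 i * slope h (delta_mx 0 i)).
  apply: continuous_big; first exact: add_continuous.
  move=> i _ x; exact: (cvgMr_tmp (@coord_continuous R 1 d 0 i x)).
by move=> x; apply: (cvgD (cvg_cst _) (C x)).
Qed.

Lemma affine_funD h1 h2 : affine_fun h1 -> affine_fun h2 ->
  affine_fun (fun x => h1 x + h2 x).
Proof.
move=> [l1 [b1 E1]] [l2 [b2 E2]].
exists (l1 \+ l2 : {scalar 'rV[R]_d}), (b1 + b2) => x; rewrite E1 E2 /=; lra.
Qed.

Lemma affine_fun0 : affine_fun (fun _ : 'rV[R]_d => 0 : R).
Proof. by exists (\0 : {scalar 'rV[R]_d}), 0 => x; rewrite addr0. Qed.

Lemma affine_fun_sum (I : Type) (r : seq I) (A : pred I) (h : I -> 'rV[R]_d -> R) :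
  (forall i, affine_fun (h i)) -> affine_fun (fun x => \sum_(i <- r | A i) h i x).
Proof.
move=> ha; elim: r => [|i r IH].
  by under eq_fun do rewrite big_nil; apply: affine_fun0.
under eq_fun do rewrite big_cons.
by case: (A i) => //; apply: affine_funD.
Qed.

End Affine.

(** * Polyhedra, their vertices and active constraints *)

Section Polyset.
Variables (R : realType) (d m : nat) (q : 'I_m -> 'rV[R]_d -> R).
Hypothesis qaff : forall j, affine_fun (q j).
Implicit Types (x u v : 'rV[R]_d).

Definition polyset : set 'rV[R]_d := [set x | forall j, 0 <= q j x].

Definition active x : {set 'I_m} := [set j | q j x == 0]%SET.

(** The constraints of A have linear parts that separate points; a point of the
    polyhedron at which the active constraints are rigid is a vertex. *)
Definition rigid (A : {set 'I_m}) : Prop :=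
  forall u, (forall j, j \in A -> slope (q j) u = 0) -> u = 0.

(** One radius serves for all constraints: the ratios of slope to value are
    bounded by their sum. *)
Lemma pos_stable x u : exists2 e, 0 < e &
  forall t, `|t| <= e -> forall j, 0 < q j x -> 0 < q j (x + t *: u).
Proof.
pose S := \sum_(j | 0 < q j x) `|slope (q j) u| / q j x.
have S0 : 0 <= S by apply: sumr_ge0 => j jx; rewrite divr_ge0 ?(ltW jx).
exists (1 + S)^-1 => [|t te j jx]; first by rewrite invr_gt0; lra.
rewrite affine_ray //.
have jS : `|slope (q j) u| <= S * q j x.
  rewrite -ler_pdivrMr // /S (bigD1 j) //= lerDl sumr_ge0 // => i /andP[ix _].
  by rewrite divr_ge0 ?(ltW ix).
have : `|t * slope (q j) u| < q j x.
  rewrite normrM (le_lt_trans (ler_pM _ _ te jS)) // mulrC ltr_pdivrMr; last lra.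
  nra.
by rewrite ltr_norml => /andP[? _]; lra.
Qed.

Lemma active_pos x j : polyset x -> j \notin active x -> 0 < q j x.
Proof. by move=> Px; rewrite inE => jx; rewrite lt_neqAle eq_sym jx Px. Qed.

Lemma polyset_stable x u : polyset x ->
  (forall j, j \in active x -> slope (q j) u = 0) ->
  exists2 e, 0 < e & forall t, `|t| <= e -> polyset (x + t *: u).
Proof.
move=> Px ux; have [e e0 he] := pos_stable x u.
exists e => // t te j; have [jx|jx] := boolP (j \in active x).
  by rewrite affine_ray // ux // mulr0 addr0.
by apply/ltW/he => //; apply: active_pos.
Qed.

Lemma polyset_comb s a b : 0 <= s <= 1 -> polyset a -> polyset b ->
  polyset (s *: a + (1 - s) *: b).
Proof.
move=> /andP[s0 s1] Pa Pb j; rewrite affine_comb //.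
by rewrite addr_ge0 ?mulr_ge0 ?Pa ?Pb //; lra.
Qed.

Lemma rigid_inj A x y : rigid A -> A \subset active x -> A \subset active y -> x = y.
Proof.
move=> rA /fintype.subsetP Ax /fintype.subsetP Ay; apply/subr0_eq/rA => j jA.
have := Ax _ jA; have := Ay _ jA; rewrite !inE affine_sub // => /eqP -> /eqP ->.
by rewrite subrr.
Qed.

(** If some direction u kills the active constraints, the polyhedron contains a
    segment through v in this direction, and a valid inequality that is tight at v
    is tight on all of it.  Conversely the sum of the active constraints cuts out v. *)
Lemma vertP v : vert polyset v <-> polyset v /\ rigid (active v).
Proof.
split=> [[h [ha hP hv]]|[Pv rv]].
  have [Pv h0] : (polyset `&` [set x | h x = 0]) v by rewrite -hv.
  split=> // u /(polyset_stable Pv)[e e0 He].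
  have Hp := He e; have Hm := He (- e); move: Hp Hm.
  rewrite normrN ger0_norm ?(ltW e0) // => /(_ (lexx _)) Pp /(_ (lexx _)) Pm.
  have := hP _ Pp; have := hP _ Pm; rewrite !affine_ray // h0 => h1 h2.
  have : [set v] (v + e *: u).
    by rewrite hv; split=> //=; rewrite affine_ray // h0; lra.
  move=> /= /eqP; rewrite -subr_eq0 addrAC subrr add0r scaler_eq0 gt_eqF //=.
  by move/eqP.
exists (fun x => \sum_(j in active v) q j x); split.
- exact: affine_fun_sum.
- by move=> x Px; apply: sumr_ge0 => j _; apply: Px.
apply/seteqP; split=> x.
  move=> -> /=; split=> //; apply: big1 => j.
  by rewrite inE => /eqP.
move=> [Px /eqP]; rewrite psumr_eq0; last by move=> j _; apply: Px.
move=> /allP xv; apply: (rigid_inj rv) => //; apply/fintype.subsetP => j jv.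
by have := xv j; rewrite mem_index_enum jv inE => /(_ isT).
Qed.

(** A vertex is determined by its set of active constraints. *)
Lemma vert_finite : finite_set (vert polyset).
Proof.
pose f (A : {set 'I_m}) := xget 0 [set v | vert polyset v /\ active v = A].
apply: (sub_finite_set (B := f @` setT)); last exact/finite_image/finite_finset.
move=> v vv; exists (active v) => //; rewrite /f.
case: xgetP => [w _ [/vertP[_ rw] vw]|/(_ v)[]//].
by apply: (rigid_inj rw) => //; rewrite vw.
Qed.

Hypothesis bP : bounded_set polyset.

Lemma unbounded_ray x u : u != 0 -> exists2 t, 0 < t & ~ polyset (x + t *: u).
Proof.
move=> u0; have [M [_ HM]] := bP.
have {}HM := HM (`|M| + 1); rewrite (le_lt_trans (ler_norm M)) ?ltrDl // in HM.
have nu : 0 < `|u| by rewrite normr_gt0.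
have Mx : 0 <= `|M| + `|x| by rewrite addr_ge0.
exists ((`|M| + `|x| + 2) / `|u|) => [|/(HM isT)].
  by rewrite divr_gt0 //; lra.
apply/negP; rewrite -ltNge.
have := ler_normB (x + ((`|M| + `|x| + 2) / `|u|) *: u) x.
rewrite addrAC subrr add0r normrZ ger0_norm ?divr_ge0 //; last lra.
by rewrite divfK ?gt_eqF //; lra.
Qed.

(** The ray stops at the first constraint that decreases along it; the active
    constraints are constant along the ray and stay active. *)
Lemma ray_hit x u : polyset x -> u != 0 ->
  (forall j, j \in active x -> slope (q j) u = 0) ->
  exists2 t, 0 < t & polyset (x + t *: u) /\ active x \proper active (x + t *: u).
Proof.
move=> Px u0 ux.
have [j0 j0u] : exists j, slope (q j) u < 0.
  apply: contrapT => /forallNP nu; have [t t0] := unbounded_ray x u0.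
  case=> j; rewrite affine_ray // addr_ge0 // mulr_ge0 ?(ltW t0) //.
  by rewrite leNgt; apply/negP/nu.
case: (@arg_minP _ _ _ j0 (fun j => slope (q j) u < 0)
  (fun j => q j x / - slope (q j) u)) => // j ju jmin.
have jx : j \notin active x by apply/negP => /ux ju0; rewrite ju0 ltxx in ju.
have Nju : 0 < - slope (q j) u by rewrite oppr_gt0.
have t0 : 0 < q j x / - slope (q j) u by rewrite divr_gt0 // active_pos.
exists (q j x / - slope (q j) u) => //; split=> [i|].
  rewrite affine_ray //; case: (lerP 0 (slope (q i) u)) => iu.
    by rewrite addr_ge0 // mulr_ge0 // ltW.
  have Niu : 0 < - slope (q i) u by rewrite oppr_gt0.
  have := jmin _ iu; rewrite -(ler_pM2r Niu) divfK ?gt_eqF //; lra.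
apply/properP; split.
  apply/fintype.subsetP => i ix; have := ux _ ix; move: ix; rewrite !inE affine_ray //.
  by move=> /eqP -> ->; rewrite mulr0 addr0.
by exists j => //; rewrite inE affine_ray // -[X in _ + X]opprK -mulrN divfK ?(gt_eqF Nju) // subrr.
Qed.

(** This is Minkowski's theorem in the form of an induction principle: what holds
    at the vertices and passes to segments holds on the polytope.  A point that is
    not a vertex lies between two points of the polytope with more active
    constraints, found by running along a line in both directions. *)
Lemma polyset_ind (Q : 'rV[R]_d -> Prop) x : polyset x ->
  (forall v, vert polyset v -> active x \subset active v -> Q v) ->
  (forall s a b, 0 <= s <= 1 -> Q a -> Q b -> Q (s *: a + (1 - s) *: b)) ->
  Q x.
Proof.
move=> Px Qv Qseg.
have [n] := ubnP (#|~: active x|); elim: n x Px Qv => // n IH x Px Qv.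
rewrite ltnS => xn.
have [rx|] := pselect (rigid (active x)).
  by apply: Qv => //; apply/vertP.
move=> /existsNP[u /not_implyP[ux /eqP u0]].
have step w : w != 0 -> (forall j, j \in active x -> slope (q j) w = 0) ->
    exists2 t, 0 < t & Q (x + t *: w).
  move=> w0 xw; have [t t0 [Pt xt]] := ray_hit Px w0 xw.
  exists t => //; apply: IH => //.
    move=> v vv tv; apply: Qv => //.
    by apply: fintype.subset_trans tv; apply: proper_sub.
  by apply: leq_trans xn; apply: proper_card; rewrite finset.properC.
have [t t0 Qt] := step u u0 ux.
have [|j jx|r r0 Qr] := step (- u); rewrite ?oppr_eq0 //.
  by rewrite slopeN // ux // oppr0.
have tr : 0 < t + r by rewrite addr_gt0.
have -> : x = (r / (t + r)) *: (x + t *: u) + (1 - r / (t + r)) *: (x + r *: - u).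
  by apply/rowP => i; rewrite !mxE; field; rewrite gt_eqF.
apply: Qseg => //; apply/andP; split; first by rewrite divr_ge0 // ltW.
by rewrite ler_pdivrMr // mul1r lerDr ltW.
Qed.

Lemma vert_above x : polyset x -> exists2 v, vert polyset v & active x \subset active v.
Proof.
move=> Px; pose Q (_ : 'rV[R]_d) := exists2 v, vert polyset v & active x \subset active v.
by apply: (polyset_ind (Q := Q) Px) => // v vv xv; exists v.
Qed.

End Polyset.

(** * Dimension counts and facets *)

Section SlopeKernel.
Variables (R : realType) (d : nat).
Implicit Types (h : 'rV[R]_d -> R) (x u : 'rV[R]_d).

Lemma dim_rV n : dim 'rV[R]_n = n.
Proof. by rewrite dim_matrix; exact: mul1n. Qed.

Definition slope_ker h : {vspace 'rV[R]_d} :=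
  lker (linfun (mulmxr (\col_i slope h (delta_mx 0 i)) : 'rV[R]_d -> 'rV[R]_1)).

Lemma slope_mulmx h u : affine_fun h ->
  slope h u = (u *m \col_i slope h (delta_mx 0 i)) 0 0.
Proof.
move=> ha; rewrite !mxE.
have := affine_coef u ha; have := affine_slope 0 u ha; rewrite add0r => -> /addrI ->.
by apply: eq_bigr => i _; rewrite mxE.
Qed.

Lemma mem_slope_ker h u : affine_fun h -> (u \in slope_ker h) = (slope h u == 0).
Proof.
move=> ha; rewrite memv_ker lfunE /= slope_mulmx //.
apply/eqP/eqP => [->|u0]; first by rewrite mxE.
by apply/matrixP => i j; rewrite !ord1 u0 mxE.
Qed.

Lemma dim_slope_ker h u : affine_fun h -> slope h u != 0 -> \dim (slope_ker h) = d.-1.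
Proof.
move=> ha u0; set f := linfun (mulmxr (\col_i slope h (delta_mx 0 i)) : 'rV[R]_d -> 'rV[R]_1).
have := limg_ker_dim f fullv; rewrite capfv -/(slope_ker h) dimvf dim_rV.
have : (\dim (f @: fullv) <= 1)%N by rewrite (leq_trans (dimvS (subvf _))) // dimvf dim_rV.
have : (0 < \dim (f @: fullv))%N.
  rewrite lt0n dimv_eq0; apply: contra_neq u0 => f0.
  have : f u \in (f @: fullv)%VS by rewrite memv_img // memvf.
  by rewrite f0 memv0 lfunE /= => /eqP e; rewrite slope_mulmx // e mxE.
case: (\dim (f @: fullv)) => [//|[|//]] _ _; rewrite addn1 => e.
by apply/eqP; rewrite -eqSS e prednK // -e.
Qed.

End SlopeKernel.

Section Facets.
Variables (R : realType) (d : nat).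
Implicit Types (h : 'rV[R]_d -> R) (x u : 'rV[R]_d) (C P F : set 'rV[R]_d).

(** The midpoint of two points of C is positive for each constraint that is
    positive at one of them. *)
Lemma common_pos (I : eqType) (s : seq I) (h : I -> 'rV[R]_d -> R) C :
  (forall i, affine_fun (h i)) ->
  (forall a b, C a -> C b -> C (2^-1 *: a + (1 - 2^-1) *: b)) ->
  (forall i x, i \in s -> C x -> 0 <= h i x) ->
  C !=set0 ->
  (forall i, i \in s -> exists2 x, C x & 0 < h i x) ->
  exists2 x, C x & forall i, i \in s -> 0 < h i x.
Proof.
move=> ha Cm hC [x0 Cx0]; elim: s hC => [|i s IH] hC hpos; first by exists x0.
have [j x js|j js|x Cx xpos] := IH.
- by apply: hC; rewrite inE js orbT.
- by apply: hpos; rewrite inE js orbT.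
have [y Cy ypos] := hpos i (mem_head _ _).
exists (2^-1 *: x + (1 - 2^-1) *: y) => [|j js]; first exact: Cm.
rewrite affine_comb //.
have := hC j x js Cx; have := hC j y js Cy => hy hx.
move: js; rewrite inE => /orP[/eqP ji|/xpos]; last by lra.
by move: ypos; rewrite -ji; lra.
Qed.

Lemma affine_const h x y : affine_fun h -> (forall u, slope h u = 0) -> h x = h y.
Proof. by move=> ha s0; rewrite -(subrK x y) addrC affine_slope // s0 addr0. Qed.

Lemma has_dim_full_pos P h y : has_dim P d -> affine_fun h ->
  (forall x, P x -> 0 <= h x) -> h y != 0 -> exists2 x, P x & 0 < h x.
Proof.
move=> [x0 [U [Px0 PU Umin dU]]] ha hP y0; apply: contrapT => np.
have h0 x : P x -> h x = 0.
  move=> Px; apply/eqP; rewrite eq_le hP // andbT leNgt; apply/negP => hx.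
  by apply: np; exists x.
have /subvP UK : (U <= slope_ker h)%VS.
  by apply: Umin => x Px; rewrite mem_slope_ker // affine_sub // !h0 // subrr.
have Ufull : U = fullv by apply/eqP; rewrite eqEdim subvf dimvf dim_rV dU /=.
have s0 u : slope h u = 0.
  by apply/eqP; rewrite -mem_slope_ker // UK // Ufull memvf.
by move: y0; rewrite (affine_const y x0 ha s0) h0 // eqxx.
Qed.

Variables (m : nat) (q : 'I_m -> 'rV[R]_d -> R).
Hypothesis qaff : forall j, affine_fun (q j).

Definition qface j : set 'rV[R]_d := polyset q `&` [set x | q j x = 0].

(** If every constraint were positive somewhere on the facet, some point of the
    facet would be interior to the polyhedron, and the supporting function of the
    facet would vanish identically.  So a constraint vanishes on the facet, and a
    dimension count shows that the facet spans the hyperplane where it is zero. *)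
Lemma facet_cut F : (0 < d)%N -> has_dim (polyset q) d -> facets (polyset q) F ->
  exists j, F = qface j.
Proof.
move=> d0 dimP [[h [ha hP FE]] [x0 [U [Fx0 FU Umin dU]]]].
have FP x : F x -> polyset q x by rewrite FE => -[].
have Fh x : F x -> h x = 0 by rewrite FE => -[].
have [[j [y y0] jF]|no] := pselect (exists2 j, exists y, q j y != 0 & forall x, F x -> q j x = 0).
  exists j; apply/seteqP; split=> x; first by move=> Fx; split; [exact: FP|exact: jF].
  have u0 : slope (q j) (y - x0) != 0 by rewrite affine_sub // (jF _ Fx0) subr0.
  have UE : U = slope_ker (q j).
    apply/eqP; rewrite eqEdim (dim_slope_ker (qaff j) u0) dU leqnn andbT.
    by apply: Umin => z Fz; rewrite mem_slope_ker // affine_sub // !jF // subrr.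
  have /subvP UK : (U <= slope_ker h)%VS.
    by apply: Umin => z Fz; rewrite mem_slope_ker // affine_sub // !Fh // subrr.
  move=> [Px qx]; rewrite FE; split=> //=.
  have : x - x0 \in slope_ker h.
    by rewrite UK // UE mem_slope_ker // affine_sub // (jF _ Fx0) subr0; apply/eqP.
  by rewrite mem_slope_ker // affine_sub // (Fh x0) // subr0 => /eqP.
pose J := [seq j <- enum 'I_m | `[< exists y, q j y != 0 >]].
have JP j : j \in J -> exists y, q j y != 0 by rewrite mem_filter => /andP[/asboolP].
have [||||z Fz zpos] := @common_pos _ J q F qaff.
- move=> a b Fa Fb; rewrite FE; split.
    by apply: polyset_comb => //; [lra|exact: FP|exact: FP].
  by rewrite /= affine_comb // !Fh // !mulr0 addr0.
- by move=> i x _ /FP; apply.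
- by exists x0.
- move=> i iJ; apply: contrapT => np; apply: no; exists i; first exact: JP.
  move=> x Fx; apply/eqP; rewrite eq_le (FP x) // andbT leNgt; apply/negP => hx.
  by apply: np; exists x.
have s0 u : slope h u = 0.
  have [e e0 He] := pos_stable qaff z u.
  have Pt t : `|t| <= e -> polyset q (z + t *: u).
    move=> te j; have [jJ|jJ] := boolP (j \in J); first exact/ltW/He/zpos.
    have -> : q j (z + t *: u) = 0 => //.
    apply/eqP/negPn/negP => qn; move: jJ; rewrite mem_filter mem_enum andbT => /asboolP.
    by apply; exists (z + t *: u).
  have := hP _ (Pt e _); have := hP _ (Pt (- e) _).
  rewrite normrN ger0_norm ?(ltW e0) // !affine_ray // (Fh z) //.
  move=> /(_ (lexx _)) h1 /(_ (lexx _)) h2; nra.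
have hc x : h x = 0 by rewrite (affine_const x x0 ha s0) Fh.
have [x1 [V [Px1 PV Vmin dV]]] := dimP.
have PF x : polyset q x -> F x by move=> Px; rewrite FE; split=> //=.
have /dimvS : (V <= U)%VS.
  apply: Vmin => x Px; have -> : x - x1 = (x - x0) - (x1 - x0).
    by rewrite opprB addrA subrK.
  by rewrite rpredB // FU //; apply: PF.
by rewrite dU dV -ltnS prednK // ltnn.
Qed.

End Facets.

(** A surjection onto a set with as many elements as the source is injective.  It
    is applied to the map from constraints to faces, when the number of constraints
    is the number of facets. *)
Lemma card_surj_inj (T : choiceType) (A : set T) (m : nat) (phi : 'I_m -> T) :
  (A #= `I_m)%card -> (forall F, A F -> exists j, F = phi j) ->
  injective phi /\ forall j, A (phi j).
Proof.
move=> Am surj; have Afin : finite_set A by exists m.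
have sub : {subset enum_fset (fset_set A) <= codom phi}.
  by move=> F; rewrite in_fset_set // inE => /surj[j ->]; rewrite codom_f.
have sz : (size (codom phi) <= size (enum_fset (fset_set A)))%N.
  by rewrite size_codom card_ord -[leqRHS]/(#|` fset_set A|) (card_fset_set Am).
split; first by apply/injectiveP; exact: leq_size_uniq (fset_uniq _) sub sz.
move=> j; have [_ e] := uniq_min_size (fset_uniq _) sub sz.
by have := codom_f phi j; rewrite -e in_fset_set // inE.
Qed.

Lemma card_inj_eq (T : choiceType) (I : finType) (D : {set I}) (A : set T) (n : nat)
    (phi : I -> T) : injective phi -> (forall F, A F <-> exists2 j, j \in D & F = phi j) ->
  (A #= `I_n)%card <-> #|D| = n.
Proof.
move=> inj AE.
have -> : A = [set` [fset phi j | j in D]%fset].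
  apply/seteqP; split=> F /=.
    by move=> /AE[j jD ->]; apply/imfsetP; exists j.
  by move=> /imfsetP[j /= jD ->]; apply/AE; exists j.
have <- : #|` [fset phi j | j in D]%fset| = #|D| by rewrite card_imfset //= -cardE.
by split=> /card_eq_fsetP.
Qed.

(** * Irredundant representations *)

Section FacetRepresentation.
Variables (R : realType) (d : nat) (P : set 'rV[R]_d).
Hypotheses (d0 : (0 < d)%N) (dimP : has_dim P d).

Definition halfspace_rep n := exists q : 'I_n -> 'rV[R]_d -> R,
  (forall j, affine_fun (q j)) /\ P = polyset q.

(** A constraint that follows from the others could be dropped. *)
Lemma minimal_rep_irredundant n (q : 'I_n -> 'rV[R]_d -> R) :
  (forall j, affine_fun (q j)) -> P = polyset q ->
  (forall k, halfspace_rep k -> (n <= k)%N) ->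
  forall j, exists x, q j x < 0 /\ forall i, i != j -> 0 <= q i x.
Proof.
case: n q => [|n] q qaff PE nmin j; first by case: j.
apply: contrapT => no; suff /nmin : halfspace_rep n by rewrite ltnn.
exists (fun i => q (lift j i)); split=> [i|]; first exact: qaff.
rewrite PE; apply/seteqP; split=> x qx i /=; first exact: qx.
have qj k : k != j -> 0 <= q k x.
  by rewrite eq_sym => /unlift_some[k' -> _]; apply: qx.
have [->|ij] := eqVneq i j; last exact: qj.
by rewrite leNgt; apply/negP => jx; apply: no; exists x.
Qed.

(** On the segment from an interior point to a point that violates only the j-th
    constraint, the point where this constraint vanishes satisfies the others
    strictly. *)
Lemma irredundant_cut n (q : 'I_n -> 'rV[R]_d -> R) :
  (forall j, affine_fun (q j)) -> P = polyset q ->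
  (forall j, exists x, q j x < 0 /\ forall i, i != j -> 0 <= q i x) ->
  forall j, exists y, q j y = 0 /\ forall i, i != j -> 0 < q i y.
Proof.
move=> qaff PE irr j.
have Pq i x : P x -> 0 <= q i x by rewrite PE; apply.
have [||||z Pz zpos] := @common_pos R d _ (enum 'I_n) q P qaff.
- by move=> a b Pa Pb; rewrite PE; apply: polyset_comb; rewrite -?PE //; lra.
- by move=> i x _; apply: Pq.
- by have [x0 [U [Px0 _ _ _]]] := dimP; exists x0.
- move=> i _; have [x [ix _]] := irr i.
  by apply: (has_dim_full_pos (y := x)) => //; [exact: Pq|rewrite lt_eqF].
have {}zpos i : 0 < q i z by apply: zpos; rewrite mem_enum.
have [x [jx ix]] := irr j; have jz := zpos j.
set a := q j z in jz; set b := q j x in jx.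
have ab : 0 < a - b by lra.
have s0 : 0 < - b / (a - b) by rewrite divr_gt0 // oppr_gt0.
exists ((- b / (a - b)) *: z + (1 - (- b / (a - b))) *: x); split.
  by rewrite affine_comb // -/a -/b; field; rewrite gt_eqF.
move=> i ij; rewrite affine_comb // ltr_pwDl //; first by rewrite mulr_gt0.
rewrite mulr_ge0 ?ix // subr_ge0 ler_pdivrMr // mul1r; lra.
Qed.

Lemma cut_facet n (q : 'I_n -> 'rV[R]_d -> R) j y :
  (forall j, affine_fun (q j)) -> P = polyset q ->
  q j y = 0 -> (forall i, i != j -> 0 < q i y) -> (exists x, q j x != 0) ->
  facets P (qface q j).
Proof.
move=> qaff PE jy iy [x xj]; rewrite PE.
have Py : polyset q y.
  by move=> i; have [->|/iy/ltW//] := eqVneq i j; rewrite jy.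
have u0 : slope (q j) (x - y) != 0 by rewrite affine_sub // jy subr0.
split; first by exists (q j); split=> // z; apply.
exists y, (slope_ker (q j)); split=> //.
- by move=> z [_ /= jz]; rewrite mem_slope_ker // affine_sub // jz jy subrr.
- move=> V yV; apply/subvP => w; rewrite mem_slope_ker // => /eqP w0.
  have [e e0 He] := pos_stable qaff y w.
  have jw : q j (y + e *: w) = 0 by rewrite affine_ray // jy w0 mulr0 addr0.
  have /yV : qface q j (y + e *: w).
    split=> //= i; have [->|ij] := eqVneq i j; first by rewrite jw.
    by apply/ltW/He; rewrite ?iy // ger0_norm // ltW.
  by rewrite addrAC subrr add0r rpredZeq gt_eqF.
exact: (dim_slope_ker (qaff j) u0).
Qed.

Lemma facet_rep : polyhedron P -> exists n (q : 'I_n -> 'rV[R]_d -> R),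
  [/\ forall j, affine_fun (q j), P = polyset q & (facets P #= `I_n)%card].
Proof.
move=> [n0 rep0].
have ex : exists n, `[< halfspace_rep n >] by exists n0; apply/asboolP.
case: (ex_minnP ex) => n /asboolP[q [qaff PE]] nmin.
exists n, q; split=> //.
have irr : forall j, exists x, q j x < 0 /\ forall i, i != j -> 0 <= q i x.
  by apply: minimal_rep_irredundant => // k /asboolP; apply: nmin.
have cutP := irredundant_cut qaff PE irr.
apply/(@card_inj_eq _ _ [set: 'I_n]%SET _ n (qface q)); last by rewrite cardsT card_ord.
  move=> i j ij; apply/eqP/negPn/negP => nij.
  have [y [jy iy]] := cutP j.
  have : qface q j y.
    split=> //= k; have [->|/iy/ltW//] := eqVneq k j; by rewrite jy.
  by rewrite -ij => -[_ /= y0]; have := iy i nij; rewrite y0 ltxx.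
move=> F; split=> [FF|[j _ ->]].
  have dimq : has_dim (polyset q) d by rewrite -PE.
  rewrite PE in FF; have [j FE] := facet_cut qaff d0 dimq FF.
  by exists j; rewrite ?inE.
have [y [jy iy]] := cutP j; have [x [xj _]] := irr j.
by apply: (cut_facet (y := y)) => //; exists x; rewrite lt_eqF.
Qed.

End FacetRepresentation.

(** * Vertices of simple polytopes *)

Section VertexFrame.
Variables (R : realType) (d m : nat) (q : 'I_m -> 'rV[R]_d -> R).
Hypothesis qaff : forall j, affine_fun (q j).

(** The d linear parts are injective on R^d, hence form a basis of the dual space;
    the rows of E form the dual basis. *)
Lemma rigid_frame (A : {set 'I_m}) : rigid q A -> #|A| = d ->
  exists (a : 'I_d -> 'I_m) (E : 'M[R]_d),
  [/\ injective a, forall j, j \in A <-> exists k, j = a k,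
      forall k c, slope (q (a k)) (c *m E) = c 0 k &
      forall u, u = (\row_k slope (q (a k)) u) *m E].
Proof.
move=> rA Ad; pose a k := enum_val (cast_ord (esym Ad) k).
pose L := \matrix_(i < d, k < d) slope (q (a k)) (delta_mx 0 i).
have uL u : u *m L = \row_k slope (q (a k)) u.
  apply/rowP => k; rewrite !mxE slope_mulmx // mxE.
  by apply: eq_bigr => i _; rewrite !mxE.
have aP j : j \in A <-> exists k, j = a k.
  split=> [jA|[k ->]]; last exact: enum_valP.
  exists (cast_ord Ad (enum_rank_in jA j)).
  by rewrite /a cast_ordK enum_rankK_in.
have Lu : L \in unitmx.
  rewrite -row_free_unit; apply: inj_row_free => u uL0; apply: rA => j /aP[k ->].
  by have := uL u; rewrite uL0 => /rowP/(_ k); rewrite !mxE.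
exists a, (invmx L); split=> //.
- by move=> i j /enum_val_inj/cast_ord_inj.
- by move=> k c; have := uL (c *m invmx L); rewrite mulmxKV // => /rowP/(_ k); rewrite mxE.
- by move=> u; rewrite -uL mulmxK.
Qed.

End VertexFrame.

Section SimplePolytope.
Variables (R : realType) (d m : nat) (q : 'I_m -> 'rV[R]_d -> R).
Hypotheses (d0 : (0 < d)%N) (qaff : forall j, affine_fun (q j)).
Hypotheses (simpleP : simple_polytope (polyset q)) (Pm : (facets (polyset q) #= `I_m)%card).

(** The constraints correspond bijectively to the facets, so the constraints
    that are active at v are as many as the facets through v, and these are d by
    simplicity. *)
Lemma simple_active v : vert (polyset q) v -> #|active q v| = d.
Proof.
have [[_ _ dimP] simp] := simpleP.
have [inj cutF] := card_surj_inj Pm (fun F => facet_cut qaff d0 dimP (F := F)).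
move=> vv; have [Pv rv] := (vertP qaff v).1 vv.
have eqv F : [set F | facets (polyset q) F /\ F v] F <->
    exists2 j, j \in active q v & F = qface q j.
  split=> [[FF Fv]|[j]].
    have [j Fj] := facet_cut qaff d0 dimP FF.
    by exists j => //; rewrite inE; move: Fv; rewrite Fj => -[_ /= ->].
  by rewrite inE => /eqP jv ->; split; [exact: cutF|split].
by have [+ _] := card_inj_eq d inj eqv; apply; apply: simp.
Qed.

(** The active constraints at x are contained in those at some vertex, and are
    fewer because they are not rigid. *)
Lemma nonvertex_active x : polyset q x -> ~ vert (polyset q) x -> (#|active q x| < d)%N.
Proof.
move=> Px nv; have [[_ bP _] _] := simpleP.
have [v vv xv] := vert_above qaff bP Px.
rewrite (leq_trans _ (eq_leq (simple_active vv))) //; apply: proper_card.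
rewrite finset.properEneq xv andbT.
apply/eqP => xE; apply: nv; apply/vertP => //; split=> //.
by rewrite xE; have [] := (vertP qaff v).1 vv.
Qed.

End SimplePolytope.

Lemma norm_affine_continuous (R : realType) (d : nat) (h : 'rV[R]_d -> R) :
  affine_fun h -> continuous (fun x => `|h x|).
Proof.
by move=> ha x; exact: (cvg_norm (@affine_continuous _ _ h ha x)).
Qed.

Lemma near_forall (T : topologicalType) (z : T) (I : finType) (Q : I -> T -> Prop) :
  (forall i, \forall x \near z, Q i x) -> \forall x \near z, forall i, Q i x.
Proof. by move=> H; apply: (filter_forall (F := nbhs z) (f := Q)). Qed.

(** * Local description by symmetric sums *)

Section LocalDescription.
Variables (R : realType) (d m : nat) (q : 'I_m -> 'rV[R]_d -> R).
Hypotheses (d2 : (2 <= d)%N) (qaff : forall j, affine_fun (q j)).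
Hypotheses (simpleP : simple_polytope (polyset q)) (Pm : (facets (polyset q) #= `I_m)%card).
Let d0 : (0 < d)%N := ltnW d2.
Implicit Types (x u v z : 'rV[R]_d).

Lemma sym_sum_active_pos z l : polyset q z -> (l <= m - #|active q z|)%N ->
  0 < sym_sum (q^~ z) l.
Proof.
move=> Pz lm.
pose h : {set 'I_m} := [set j in take l (enum (~: active q z))]%SET.
have hl : #|h| == l.
  rewrite cardsE; apply/eqP/etrans; first by apply/card_uniqP/take_uniq/enum_uniq.
  by rewrite size_takel // -cardE cardsCs finset.setCK card_ord.
rewrite /sym_sum (bigD1 h) //= ltr_pwDl //.
  apply: prodr_gt0 => j; rewrite inE => /mem_take; rewrite mem_enum finset.in_setC.
  exact: active_pos.
by apply: sumr_ge0 => k _; apply: prodr_ge0 => j _; apply: Pz.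
Qed.

Lemma sym_sum_continuous l : continuous (fun x => sym_sum (q^~ x) l).
Proof.
apply: continuous_big; first exact: add_continuous.
move=> h _; apply: continuous_big; first exact: mul_continuous.
by move=> j _; exact: (affine_continuous (qaff j)).
Qed.

Lemma near_lt (f : 'rV[R]_d -> R) z c : continuous f -> c < f z -> \forall x \near z, c < f x.
Proof. by move=> fc cz; apply: (cvgr_gt (f z) (fc z)). Qed.

Lemma near_gt (f : 'rV[R]_d -> R) z c : continuous f -> f z < c -> \forall x \near z, f x < c.
Proof. by move=> fc cz; apply: (cvgr_lt (f z) (fc z)). Qed.

Lemma near_sym_sum_pos z : polyset q z ->
  \forall x \near z, forall l, (l <= m - #|active q z|)%N -> 0 < sym_sum (q^~ x) l.
Proof.
move=> Pz; set n := (m - _)%N.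
have : \forall x \near z, forall l : 'I_n.+1, 0 < sym_sum (q^~ x) l.
  apply: near_forall => l; apply: near_lt; first exact: sym_sum_continuous.
  by apply: sym_sum_active_pos => //; rewrite -ltnS.
by apply: filterS => x H l ln; apply: (H (Ordinal (ln : (l < n.+1)%N))).
Qed.

(** These sums are the values p_1(x), ..., p_(d-1)(x). *)
Definition sym_ge0 x := forall i, (1 <= i <= d - 1)%N -> 0 <= sym_sum (q^~ x) (m - d + i + 1).

Lemma polyset_sym_ge0 x : polyset q x -> forall l, 0 <= sym_sum (q^~ x) l.
Proof. by move=> Px l; apply: sumr_ge0 => h _; apply: prodr_ge0 => j _; apply: Px. Qed.

Lemma sym_sum_all_ge0 x n : (n <= m)%N ->
  (forall l, (l <= n)%N -> 0 <= sym_sum (q^~ x) l) ->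
  (forall l, (n < l <= m)%N -> 0 <= sym_sum (q^~ x) l) -> polyset q x.
Proof.
move=> nm lo hi j; apply: (@sym_sum_ge0 _ _ (q^~ x)) => l; rewrite card_ord => lm.
by have [/lo//|nl] := leqP l n; apply: hi; rewrite nl.
Qed.

Lemma exists_active : exists v, vert (polyset q) v.
Proof.
have [[_ bP [x0 [U [Px0 _ _ _]]]] _] := simpleP.
by have [v vv _] := vert_above qaff bP Px0; exists v.
Qed.

Lemma dim_le_facets : (d <= m)%N.
Proof.
have [v vv] := exists_active.
rewrite (leq_trans (eq_leq (esym (simple_active d0 qaff simpleP Pm vv)))) //.
by rewrite -[leqRHS]card_ord max_card.
Qed.

Lemma sym_ge0_top x l : sym_ge0 x -> (m - d + 2 <= l <= m)%N -> 0 <= sym_sum (q^~ x) l.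
Proof.
move=> sx /andP[l1 l2]; have dm := dim_le_facets.
by have := sx (l - (m - d + 1))%N; rewrite (_ : (m - d + _ + 1)%N = l); [apply; lia|lia].
Qed.

Lemma near_nonvertex z : polyset q z -> ~ vert (polyset q) z ->
  \forall x \near z, sym_ge0 x -> polyset q x.
Proof.
move=> Pz nz; have zd := nonvertex_active d0 qaff simpleP Pm Pz nz.
have dm := dim_le_facets.
apply: filterS (near_sym_sum_pos Pz) => x xpos sx.
apply: (@sym_sum_all_ge0 _ (m - d + 1)) => [|l lm|l /andP[l1 l2]].
- by lia.
- by apply/ltW/xpos; lia.
- by apply: sym_ge0_top => //; lia.
Qed.

(** The constraints that are active at v are affine coordinates, so they control
    the other constraints and the coordinates of x - v. *)
Lemma vertex_displacement v : vert (polyset q) v ->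
  exists2 C, 0 <= C & forall x M, (forall j, j \in active q v -> `|q j x| <= M) ->
    \sum_j `|q j x - q j v| <= C * M /\ (forall i, `|x 0 i - v 0 i| <= C * M).
Proof.
move=> vv; have [Pv rv] := (vertP qaff v).1 vv.
have [a [E [_ aP _ uE]]] := rigid_frame qaff rv (simple_active d0 qaff simpleP Pm vv).
pose C1 := \sum_j \sum_k `|slope (q j) (row k E)|.
pose C2 := \sum_i \sum_k `|E k i|.
have C10 : 0 <= C1 by apply: sumr_ge0 => j _; apply: sumr_ge0.
have C20 : 0 <= C2 by apply: sumr_ge0 => j _; apply: sumr_ge0.
exists (C1 + C2); first by rewrite addr_ge0.
move=> x M xM.
have M0 : 0 <= M.
  have av : a (Ordinal d0) \in active q v by apply/aP; exists (Ordinal d0).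
  exact: le_trans (xM _ av).
pose c := \row_k slope (q (a k)) (x - v).
have cM k : `|c 0 k| <= M.
  have av : a k \in active q v by apply/aP; exists k.
  rewrite mxE affine_sub //; move: (av); rewrite inE => /eqP ->; rewrite subr0.
  exact: xM.
split.
  apply: (@le_trans _ _ (C1 * M)); last by rewrite mulrDl lerDl mulr_ge0.
  rewrite mulr_suml; apply: ler_sum => j _; rewrite -affine_sub // [x - v]uE -/c.
  have [l lE] := slope_scalar (qaff j).
  rewrite mulmx_sum_row lE linear_sum mulr_suml (le_trans (ler_norm_sum _ _ _)) //.
  apply: ler_sum => k _; rewrite linearZ normrM -lE mulrC ler_wpM2l //.
move=> i; apply: (@le_trans _ _ (C2 * M)); last by rewrite mulrDl lerDr mulr_ge0.
have -> : x 0 i - v 0 i = (x - v) 0 i by rewrite !mxE.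
rewrite [x - v]uE -/c mxE (le_trans (ler_norm_sum _ _ _)) //.
apply: (@le_trans _ _ ((\sum_k `|E k i|) * M)); last first.
  rewrite ler_wpM2r // [leRHS](bigD1 i) //= lerDl.
  by apply: sumr_ge0 => k _; apply: sumr_ge0.
rewrite mulr_suml; apply: ler_sum => k _; rewrite normrM mulrC ler_wpM2l //.
Qed.

(** The bound sym_sum_near_vertex is applied with M the largest absolute value at x
    of the constraints that are active at v.  The error term is measured by all
    constraints because that is what the power sums yield; it is a small multiple
    of M by vertex_displacement. *)
Lemma near_vertex v : vert (polyset q) v -> exists2 eta, 0 < eta &
  \forall x \near v, sym_ge0 x ->
    - (eta * \sum_j `|q j x - q j v|) <= \sum_(j in active q v) q j x -> polyset q x.
Proof.
move=> vv; have [Pv rv] := (vertP qaff v).1 vv.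
have [C C0 HC] := vertex_displacement vv.
have Ad := simple_active d0 qaff simpleP Pm vv.
have top : (m - d + 2 <= m)%N by have := dim_le_facets; clear -d2; lia.
set A := active q v in Ad *.
pose B := \prod_(j in ~: A) q j v.
have B0 : 0 < B.
  by apply: prodr_gt0 => j; rewrite finset.in_setC; apply: active_pos.
pose K := 1 + \sum_j `|q j v|.
have K1 : 1 <= K by rewrite lerDl sumr_ge0.
have [||//|M0 M00 HM] := @sym_sum_near_vertex R _ A (B / 2) K.
- by rewrite (leq_trans d2) // Ad.
- by rewrite divr_gt0.
(* Since the sum of the displacements is at most C M, this makes the error at most M / 4. *)
exists (4 * (C + 1))^-1; first by rewrite invr_gt0; lra.
have nK : \forall x \near v, forall j, `|q j x| < K.
  apply: near_forall => j; apply: (near_gt (f := fun x => `|q j x|)).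
    exact: (norm_affine_continuous (qaff j)).
  by rewrite /K (bigD1 j) //=; rewrite addrCA ltrDl ltr_pwDl ?sumr_ge0.
have nM : \forall x \near v, forall j, j \in A -> `|q j x| < M0.
  apply: near_forall => j; have [jA|jA] := boolP (j \in A); last first.
    have H x : false -> `|q j x| < M0 by [].
    exact: (filterS (F := nbhs v) (fun x _ => H x) filterT).
  have : \forall x \near v, `|q j x| < M0.
    apply: (near_gt (f := fun x => `|q j x|)).
      exact: (norm_affine_continuous (qaff j)).
    by move: jA; rewrite inE => /eqP ->; rewrite normr0.
  by apply: filterS.
have nB : \forall x \near v, B / 2 < \prod_(j in ~: A) q j x.
  apply: (near_lt (f := fun x => \prod_(j in ~: A) q j x)); last by rewrite -/B; lra.
  apply: continuous_big; first exact: mul_continuous.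
  by move=> j _; exact: (affine_continuous (qaff j)).
apply: filterS (filterI (filterI nK nM) (filterI nB (near_sym_sum_pos Pv))).
move=> x [[xK xM] [xB xpos]] sx ex.
have [j0 j0A] : exists j, j \in A by apply/card_gt0P; rewrite Ad.
case: (@arg_maxP _ _ _ j0 (mem A) (fun j => `|q j x|)) => // j1 j1A j1max.
have s1 : 0 <= sym_sum (q^~ x) (m - d + 1).
  rewrite -Ad -[X in (X - _)%N]card_ord.
  apply: (HM (q^~ x) `|q j1 x|).
  - exact/ltW/xM.
  - by move=> j _; apply/ltW/xK.
  - exact: ltW.
  - exact: j1max.
  - by exists j1.
  - apply: le_trans ex; rewrite lerN2.
    have [HC1 _] := HC x `|q j1 x| j1max.
    have N0 := normr_ge0 (q j1 x).
    rewrite mulrC ler_pdivrMr; last lra.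
    apply: (le_trans HC1); nra.
  by rewrite card_ord Ad; apply: sym_ge0_top; rewrite // leqnn top.
apply: (@sym_sum_all_ge0 _ (m - d + 1)) => [|l lm|l /andP[l1 l2]].
- by apply: leq_trans top; rewrite leq_add2l.
- have [->//|ne] := eqVneq l (m - d + 1)%N.
  apply/ltW/xpos; rewrite -/A Ad.
  by have : (l < m - d + 1)%N by [rewrite ltn_neqAle ne]; rewrite addn1 ltnS.
- by apply: sym_ge0_top; rewrite // l2 andbT addn2 -addn1.
Qed.

(** Otherwise, taking eps = 1 / (n + 1), there are points outside the polytope that
    satisfy all these conditions.  They stay in a box, hence accumulate at a point z,
    which belongs to the polytope because eps tends to 0; this contradicts the local
    statement at z. *)
Lemma near_polytope (K : R) : exists2 eps, 0 < eps &
  forall x, (forall j, - eps <= q j x) -> (forall j, `|q j x| <= K) ->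
    (forall v, vert (polyset q) v ->
      - (eps * \sum_j `|q j x - q j v|) <= \sum_(j in active q v) q j x) ->
    sym_ge0 x -> polyset q x.
Proof.
apply: contrapT => no.
pose e n : R := n.+1%:R^-1.
have e0 n : 0 < e n by rewrite invr_gt0.
have {no} bad n : exists x, [/\ forall j, - e n <= q j x, forall j, `|q j x| <= K,
    forall v, vert (polyset q) v ->
      - (e n * \sum_j `|q j x - q j v|) <= \sum_(j in active q v) q j x,
    sym_ge0 x & ~ polyset q x].
  apply: contrapT => nx; apply: no; exists (e n) => // x h1 h2 h3 h4.
  by apply: contrapT => h5; apply: nx; exists x.
have [x xP] := choice bad.
have [v0 vv0] := exists_active.
have [C C0 HC] := vertex_displacement vv0.
pose box := [set z : 'rV[R]_d | forall i, `[v0 0 i - C * K, v0 0 i + C * K]%classic (z ord0 i)].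
have cbox : compact box.
  apply: (@rV_compact R d (fun i => `[v0 0 i - C * K, v0 0 i + C * K]%classic)) => i.
  exact: segment_compact.
have xbox n : box (x n).
  move=> i /=; rewrite in_itv /=; have [_ xK _ _ _] := xP n.
  by have [_ /(_ i)] := HC (x n) K (fun j _ => xK j); rewrite ler_norml => /andP[? ?]; lra.
have [|z [_ cz]] := cbox (x @ \oo) _; first by exists 0%N => // n _; apply: xbox.
have hit N (B : set 'rV[R]_d) : nbhs z B -> exists2 n, (N <= n)%N & B (x n).
  move=> nB; have [|w [/= [n Nn <-] Bn]] := cz (x @` [set n | (N <= n)%N]) B _ nB.
    by exists N => // n Nn /=; exists n.
  by exists n.
have esmall c : 0 < c -> exists N, forall n, (N <= n)%N -> e n <= c.
  move=> c0; exists (Num.trunc c^-1) => n; rewrite truncn_le_nat => cn.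
  by rewrite /e -[leRHS]invrK lef_pV2 ?posrE ?invr_gt0 // ltW.
have Pz : polyset q z.
  move=> j; rewrite leNgt; apply/negP => jz.
  have [|N HN] := esmall (- q j z / 2); first by rewrite divr_gt0 // oppr_gt0.
  have [|n Nn jn] := hit N [set w | q j w < q j z / 2].
    by apply: (near_gt (f := q j)); [exact: affine_continuous|lra].
  by have [/(_ j) jx _ _ _ _] := xP n; have := HN n Nn; move: jn => /= jn; lra.
have [vz|nz] := pselect (vert (polyset q) z); last first.
  have [n _ Pn] := hit 0%N _ (near_nonvertex Pz nz).
  by have [_ _ _ sx] := xP n; apply; apply: Pn.
have [eta eta0 nv] := near_vertex vz.
have [N HN] := esmall eta eta0.
have [n Nn Pn] := hit N _ nv.
have [_ _ vx sx] := xP n; apply; apply: Pn => //.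
apply: le_trans (vx z vz); rewrite lerN2 ler_wpM2r ?HN //.
exact: sumr_ge0.
Qed.

End LocalDescription.

(** * Diagonally dominant systems *)

Section DominantSystem.
Variables (R : realFieldType) (N : nat) (a : 'I_N -> 'I_N -> R) (tau : R).
Hypotheses (a1 : forall i, a i i = 1) (atau : forall i j, i != j -> 0 <= a i j <= tau).
Hypothesis (tau0 : 0 <= tau) (Ntau : N%:R * tau <= 4^-1).

Lemma dominant_offdiag (y : 'I_N -> R) (Y : R) i : (forall j, `|y j| <= Y) ->
  `|\sum_j a i j * y j - y i| <= Y / 4.
Proof.
move=> yY; have Y0 : 0 <= Y by apply: le_trans (yY i).
rewrite (bigD1 i) //= a1 mul1r addrAC subrr add0r (le_trans (ler_norm_sum _ _ _)) //.
apply: (@le_trans _ _ (\sum_(j < N) tau * Y)).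
  rewrite [leRHS](bigD1 i) //= ler_wpDl ?mulr_ge0 //; apply: ler_sum => j ji.
  rewrite eq_sym in ji; have /andP[aij0 aij1] := atau ji.
  by rewrite normrM (ger0_norm aij0) ler_pM.
by rewrite sumr_const card_ord -[_ *+ N]mulr_natl mulrA mulrC ler_wpM2l.
Qed.

Lemma dominant_bound (y : 'I_N -> R) (b : R) : (forall i, `|\sum_j a i j * y j| <= b) ->
  forall i, `|y i| <= b * 4 / 3.
Proof.
move=> yb i0; case: (@arg_maxP _ _ _ i0 xpredT (fun i => `|y i|)) => // i _ imax.
have yi j : `|y j| <= `|y i| by apply: imax.
have h := dominant_offdiag i yi; have hb := yb i.
have : `|y i| <= b + `|y i| / 4.
  apply: le_trans (lerD hb h); rewrite distrC.
  set S := \sum_j _; have := ler_normD S (y i - S); rewrite [S + _]addrC subrK.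
  by rewrite [in X in _ <= X]addrC.
by have := yi i0; lra.
Qed.

(** The matrix is close to the identity, so a solution of the homogeneous system
    is at most a quarter of itself, hence 0, and the solution for the right side 1
    is close to 1. *)
Lemma dominant_solution : exists y : 'I_N -> R,
  forall i, \sum_j a i j * y j = 1 /\ 2^-1 <= y i <= 2.
Proof.
pose M := \matrix_(j, i) a i j.
have uM (u : 'rV_N) i : (u *m M) 0 i = \sum_j a i j * u 0 j.
  by rewrite mxE; apply: eq_bigr => j _; rewrite mxE mulrC.
have Mu : M \in unitmx.
  rewrite -row_free_unit; apply: inj_row_free => u uM0; apply/rowP => i.
  rewrite mxE; apply/eqP; rewrite -normr_eq0 eq_le normr_ge0 andbT.
  have := dominant_bound (y := u 0) (b := 0) _ i; rewrite !mul0r; apply=> k.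
  by rewrite -uM uM0 mxE normr0.
pose y := (const_mx 1 : 'rV_N) *m invmx M.
have sol k : \sum_j a k j * y 0 j = 1 by rewrite -uM mulmxKV // mxE.
have yb : forall j, `|y 0 j| <= 1 * 4 / 3.
  by apply: dominant_bound => k; rewrite sol normr1.
exists (y 0) => i; split=> //.
by have := dominant_offdiag i yb; rewrite sol ler_norml => /andP[? ?]; apply/andP; split; lra.
Qed.

End DominantSystem.

(** * Convexity of the power sums at a vertex *)

Section PowerSums.
Variables (R : realType) (d m : nat) (q : 'I_m -> 'rV[R]_d -> R).
Hypotheses (d0 : (0 < d)%N) (qaff : forall j, affine_fun (q j)).
Implicit Types (x u v w z : 'rV[R]_d).

(** The inner sum of p_0 for the vertex w, with all scalars equal to lam. *)
Definition vertex_mean (k : nat) (lam : R) w x : R :=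
  d%:R^-1 * \sum_(j < m | q j w == 0) (1 - lam * q j x) ^+ (2 * k).

Lemma vertex_mean_ge0 k lam w x : 0 <= vertex_mean k lam w x.
Proof.
rewrite mulr_ge0 ?invr_ge0 //; apply: sumr_ge0 => j _.
by rewrite exprM exprn_ge0 ?sqr_ge0.
Qed.

Lemma vertex_mean_convex k lam w s a b : 0 <= s <= 1 ->
  vertex_mean k lam w (s *: a + (1 - s) *: b) <=
    s * vertex_mean k lam w a + (1 - s) * vertex_mean k lam w b.
Proof.
move=> s01; rewrite /vertex_mean ![_ * (d%:R^-1 * _)]mulrCA -mulrDr.
rewrite ler_wpM2l ?invr_ge0 // !mulr_sumr -big_split; apply: ler_sum => j _ /=.
apply: le_trans (even_exp_convex k (1 - lam * q j a) (1 - lam * q j b) s01).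
rewrite affine_comb //.
by rewrite (_ : 1 - _ = s * (1 - lam * q j a) + (1 - s) * (1 - lam * q j b)) //; ring.
Qed.

Lemma vertex_mean_pow_convex k lam w s a b : 0 <= s <= 1 ->
  vertex_mean k lam w (s *: a + (1 - s) *: b) ^+ (2 * k) <=
    s * vertex_mean k lam w a ^+ (2 * k) + (1 - s) * vertex_mean k lam w b ^+ (2 * k).
Proof.
move=> s01; apply: le_trans (even_exp_convex _ _ _ s01).
rewrite lerXn2r ?nnegrE ?vertex_mean_ge0 //; last exact: vertex_mean_convex.
case/andP: s01 => s0 s1.
by apply: addr_ge0; apply: mulr_ge0; rewrite ?vertex_mean_ge0 ?subr_ge0.
Qed.

(** Two tangents are composed: the one of the outer power at the mean in v, and
    those of the inner powers at the values 1 - lam q_j(v). *)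
Lemma vertex_mean_tangent k lam w x v :
  - ((2 * k)%:R ^+ 2 * lam / d%:R) * (vertex_mean k lam w v ^+ (2 * k).-1 *
    \sum_(j < m | q j w == 0) (1 - lam * q j v) ^+ (2 * k).-1 * (q j x - q j v))
  <= vertex_mean k lam w x ^+ (2 * k) - vertex_mean k lam w v ^+ (2 * k).
Proof.
set g := vertex_mean k lam w; set S := \sum_(j < m | _) _.
have h : g v - (2 * k)%:R * lam / d%:R * S <= g x.
  rewrite /g /vertex_mean /S [_ / d%:R]mulrC -!mulrA -mulrBr ler_wpM2l ?invr_ge0 //.
  rewrite !mulr_sumr -sumrB; apply: ler_sum => j _.
  apply: le_trans (bernoulli_tangent k _ (1 - lam * q j v)).
  rewrite le_eqVlt; apply/orP; left; apply/eqP; ring.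
have := bernoulli_tangent k (g x) (g v); rewrite addrC -lerBrDr.
apply: le_trans; set c := g v ^+ _; have c0 : 0 <= c by rewrite exprn_ge0 ?vertex_mean_ge0.
have : (2 * k)%:R * c * (- ((2 * k)%:R * lam / d%:R * S)) <= (2 * k)%:R * c * (g x - g v).
  by rewrite ler_wpM2l ?mulr_ge0 //; lra.
apply: le_trans; rewrite le_eqVlt; apply/orP; left; apply/eqP; ring.
Qed.

End PowerSums.

(** * Approximation of the polytope by the superlevel set of p_0 *)

Section PolytopeApproximation.
Variables (R : realType) (d m : nat) (q : 'I_m -> 'rV[R]_d -> R).
Hypotheses (d0 : (0 < d)%N) (qaff : forall j, affine_fun (q j)).
Hypotheses (simpleP : simple_polytope (polyset q)) (Pm : (facets (polyset q) #= `I_m)%card).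
Implicit Types (x u v w z : 'rV[R]_d).

(** A facet has a point, and the constraints that are active at this point are
    active at some vertex. *)
Lemma facet_vertex j : exists2 v, vert (polyset q) v & q j v = 0.
Proof.
have [[_ bP dimP] _] := simpleP.
have [_ cutF] := card_surj_inj Pm (fun F => facet_cut qaff d0 dimP (F := F)).
have [_ [x [U [[Px jx] _ _ _]]]] := cutF j.
have [v vv /fintype.subsetP xv] := vert_above qaff bP Px.
by exists v => //; have := xv j; rewrite !inE jx eqxx => /(_ isT)/eqP.
Qed.

Lemma vertex_enum : exists N (vt : 'I_N -> 'rV[R]_d),
  [/\ injective vt, forall i, vert (polyset q) (vt i),
      forall v, vert (polyset q) v -> exists i, v = vt i &
      forall F : 'rV[R]_d -> R, \sum_(v \in vert (polyset q)) F v = \sum_(i < N) F (vt i)].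
Proof.
have fin := vert_finite qaff.
set s := enum_fset (fset_set (vert (polyset q))).
have sv v : v \in s -> vert (polyset q) v by rewrite /s in_fset_set // inE.
exists (size s), (tnth (in_tuple s)); split=> [|i|v vv|F].
- by apply/tuple_uniqP; apply: fset_uniq.
- exact/sv/mem_tnth.
- suff /tnthP : v \in in_tuple s by [].
  by rewrite /s /= in_fset_set // inE.
by rewrite fsbig_finite // big_tnth.
Qed.

Lemma mean_on_vertex k lam v : vert (polyset q) v -> vertex_mean q k lam v v = 1.
Proof.
move=> vv; rewrite /vertex_mean (eq_bigr (fun=> 1)); last first.
  by move=> j /eqP ->; rewrite mulr0 subr0 expr1n.
rewrite sumr_const (_ : #|_| = d) ?mulVf ?pnatr_eq0 -?lt0n //.
rewrite -(simple_active d0 qaff simpleP Pm vv); apply: eq_card => j; by rewrite inE.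
Qed.

Section Vertices.
Variables (N : nat) (vt : 'I_N -> 'rV[R]_d).
Hypotheses (vt_inj : injective vt) (vtP : forall i, vert (polyset q) (vt i)).
Hypothesis vt_surj : forall v, vert (polyset q) v -> exists i, v = vt i.

Lemma vertex_scale : exists2 lam : R, 0 < lam & forall i j, lam * q j (vt i) <= 1.
Proof.
pose S := \sum_i \sum_j `|q j (vt i)|.
have S0 : 0 <= S by apply: sumr_ge0 => i _; apply: sumr_ge0.
exists (1 + S)^-1 => [|i j]; first by rewrite invr_gt0; lra.
have : `|q j (vt i)| <= S.
  rewrite /S (bigD1 i) //= (bigD1 j) //= -addrA lerDl.
  by rewrite addr_ge0 ?sumr_ge0 // => k _; apply: sumr_ge0.
have := ler_norm (q j (vt i)) => h1 h2.
by rewrite mulrC ler_pdivrMr; lra.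
Qed.

(** Some constraint through the vertex with index i is positive at the other one;
    its term is below 1 while the other terms are at most 1.  Replacing the
    exponent 2k by 1 makes the bound independent of k. *)
Lemma vertex_contraction lam : 0 < lam -> (forall i j, lam * q j (vt i) <= 1) ->
  exists2 theta : R, 0 <= theta < 1 &
  forall k i i', (0 < k)%N -> i != i' -> vertex_mean q k lam (vt i) (vt i') <= theta.
Proof.
move=> lam0 lamq.
have q0 i j : 0 <= q j (vt i) by have [Pv _] := (vertP qaff (vt i)).1 (vtP i); apply: Pv.
(* The value of the mean when the exponent 2k is replaced by 1. *)
pose r i i' : R := d%:R^-1 * \sum_(j < m | q j (vt i) == 0) (1 - lam * q j (vt i')).
exists (\big[Num.max/0]_(p : 'I_N * 'I_N | p.1 != p.2) r p.1 p.2) => [|k i i' k0 ii'].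
  rewrite bigmax_ge_id /=; apply/bigmax_ltP; split=> // -[i i'] /= ii'.
  rewrite -(mean_on_vertex 0 lam (vtP i)) ltr_pM2l ?invr_gt0 ?ltr0n //.
  have [j ji ji'] : exists2 j, q j (vt i) == 0 & q j (vt i') != 0.
    apply: contrapT => no; case/eqP: ii'; apply: vt_inj.
    have [_ rv] := (vertP qaff (vt i)).1 (vtP i).
    apply: (rigid_inj qaff rv) => //; apply/fintype.subsetP => j; rewrite !inE => ji.
    by apply/negPn/negP => ji'; apply: no; exists j.
  rewrite (bigD1 j) // [ltRHS](bigD1 j) //= expr0 ltr_leD //.
    by rewrite ltrBlDr ltrDl mulr_gt0 // lt_neqAle eq_sym ji' q0.
  by apply: ler_sum => l _; rewrite lerBlDr lerDl mulr_ge0 // ltW.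
apply: (@bigmax_sup _ _ _ _ (i, i')) => //=.
rewrite ler_wpM2l ?invr_ge0 //; apply: ler_sum => j _.
have h0 : 0 <= 1 - lam * q j (vt i') by rewrite subr_ge0.
rewrite -(prednK (_ : (0 < 2 * k)%N)) ?muln_gt0 // exprS ler_piMr // exprn_ile1 //.
by rewrite lerBlDr lerDl mulr_ge0 // ltW.
Qed.

Variables (lam theta : R).
Hypotheses (lam0 : 0 < lam) (lamq : forall i j, lam * q j (vt i) <= 1).
Hypotheses (theta01 : 0 <= theta < 1).
Hypothesis thetaP : forall k i i', (0 < k)%N -> i != i' ->
  vertex_mean q k lam (vt i) (vt i') <= theta.
Variables (k : nat) (y : 'I_N -> R).
Hypothesis k0 : (0 < k)%N.
Hypothesis ysol : forall i',
  \sum_i vertex_mean q k lam (vt i) (vt i') ^+ (2 * k) * y i = 1.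
Hypothesis y12 : forall i, 2^-1 <= y i <= 2.

Let f x := \sum_i y i * vertex_mean q k lam (vt i) x ^+ (2 * k).

Let yge i : 2^-1 <= y i. Proof. by case/andP: (y12 i). Qed.
Let yle i : y i <= 2. Proof. by case/andP: (y12 i). Qed.
Let yge0 i : 0 <= y i. Proof. by have := yge i; lra. Qed.

Lemma potential_vertex i : f (vt i) = 1.
Proof. by rewrite /f -(ysol i); apply: eq_bigr => j _; rewrite mulrC. Qed.

(** The potential, that is 1 - p_0, is convex and takes the value 1 at the
    vertices. *)
Lemma potential_le1 x : polyset q x -> f x <= 1.
Proof.
have [[_ bP _] _] := simpleP.
move=> Px; apply: (polyset_ind qaff bP (Q := fun x => f x <= 1) Px).
  by move=> v /vt_surj[i ->] _; rewrite potential_vertex.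
move=> s a b s01 fa fb; have /andP[s0 s1] := s01.
apply: (@le_trans _ _ (s * f a + (1 - s) * f b)); last first.
  have s1' : 0 <= 1 - s by lra.
  by have := ler_wpM2l s0 fa; have := ler_wpM2l s1' fb; lra.
rewrite /f !mulr_sumr -big_split; apply: ler_sum => i _ /=.
rewrite ![_ * (y i * _)]mulrCA -mulrDr ler_wpM2l //.
exact: vertex_mean_pow_convex.
Qed.

(** Each term of the potential is at most 1, and the weights are at least 1 / 2. *)
Lemma potential_bound x j : f x <= 1 -> (1 - lam * q j x) ^+ (2 * k) <= (2 * d)%:R.
Proof.
move=> fx; have [v /vt_surj[i ->] ji] := facet_vertex j.
have G0 i' z : 0 <= vertex_mean q k lam (vt i') z ^+ (2 * k) by rewrite exprn_ge0 ?vertex_mean_ge0.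
have g0 := vertex_mean_ge0 q k lam (vt i) x.
have : vertex_mean q k lam (vt i) x ^+ (2 * k) <= 2.
  have : y i * vertex_mean q k lam (vt i) x ^+ (2 * k) <= f x.
    by rewrite /f (bigD1 i) //= lerDl; apply: sumr_ge0 => l _; rewrite mulr_ge0.
  have := ler_wpM2r (G0 i x) (yge i); lra.
set g := vertex_mean _ _ _ _ _ in g0 *; move=> g2.
have {}g2 : g <= 2.
  rewrite leNgt; apply/negP => g2'; move: g2; apply/negP; rewrite -ltNge.
  have g1 : 1 <= g by lra.
  by apply: lt_le_trans g2' _; rewrite -{1}[g]expr1 ler_weXn2l // muln_gt0.
have : \sum_(j < m | q j (vt i) == 0) (1 - lam * q j x) ^+ (2 * k) <= 2 * d%:R.
  by move: g2; rewrite /g /vertex_mean mulrC ler_pdivrMr // ltr0n.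
rewrite -natrM; apply: le_trans.
rewrite (bigD1 j) /=; last by rewrite ji.
by rewrite lerDl; apply: sumr_ge0 => l _; rewrite exprM exprn_ge0 ?sqr_ge0.
Qed.

(** The tangents at the vertex v with index i give a linear lower bound of the
    potential, which equals 1 at v.  The term of v contributes a multiple of the sum
    of the active constraints; the terms of the other vertices are smaller by the
    factor theta^(2k-1). *)
Lemma potential_tangent x i : f x <= 1 ->
  - (4 * N%:R * theta ^+ (2 * k).-1 * \sum_j `|q j x - q j (vt i)|) <=
    \sum_(j in active q (vt i)) q j x.
Proof.
move=> fx; set S := \sum_j _; set e := \sum_(j in _) _; set th := theta ^+ _.
have S0 : 0 <= S by apply: sumr_ge0.
have /andP[t0 t1] := theta01.
have th0 : 0 <= th by rewrite exprn_ge0.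
pose c : R := (2 * k)%:R ^+ 2 * lam / d%:R.
have c0 : 0 < c.
  by rewrite divr_gt0 ?ltr0n // mulr_gt0 // exprn_gt0 // ltr0n muln_gt0.
pose D i' := vertex_mean q k lam (vt i') x ^+ (2 * k) -
  vertex_mean q k lam (vt i') (vt i) ^+ (2 * k).
have Dsum : \sum_i' y i' * D i' <= 0.
  have -> : \sum_i' y i' * D i' = f x - f (vt i).
    by rewrite /f -sumrB; apply: eq_bigr => i' _; rewrite mulrBr.
  by rewrite potential_vertex subr_le0.
have Di : - (c * e) <= D i.
  apply: le_trans (vertex_mean_tangent q k lam (vt i) x (vt i)).
  rewrite mean_on_vertex // expr1n mul1r -/c mulNr lerN2 ler_wpM2l ?(ltW c0) //.
  rewrite le_eqVlt; apply/orP; left; apply/eqP; apply: eq_big => j; first by rewrite inE.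
  by move=> /eqP ->; rewrite mulr0 !subr0 expr1n mul1r.
have Di' i' : i' != i -> - (c * (th * S)) <= D i'.
  move=> ne; apply: le_trans (vertex_mean_tangent q k lam (vt i') x (vt i)).
  rewrite -/c mulNr lerN2 ler_wpM2l ?(ltW c0) //.
  apply: (le_trans (ler_norm _)); rewrite normrM.
  apply: ler_pM => //.
    rewrite ger0_norm ?exprn_ge0 ?vertex_mean_ge0 // /th lerXn2r ?nnegrE ?vertex_mean_ge0 //.
    exact: thetaP.
  rewrite (le_trans (ler_norm_sum _ _ _)) //.
  rewrite /S [leRHS](bigID (fun j => q j (vt i') == 0)) /= ler_wpDr ?sumr_ge0 //.
  apply: ler_sum => j _; rewrite normrM ler_piMl // normrX.
  have q0 : 0 <= q j (vt i) by have [Pv _] := (vertP qaff (vt i)).1 (vtP i); apply: Pv.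
  rewrite exprn_ile1 // ger0_norm ?subr_ge0 ?lamq //.
  by rewrite lerBlDr lerDl mulr_ge0 // ltW.
have T0 : 0 <= c * (th * S) by apply: mulr_ge0; [exact: ltW|exact: mulr_ge0].
have : y i * D i - \sum_(i' < N) 2 * (c * (th * S)) <= 0.
  apply: le_trans Dsum; rewrite [leRHS](bigD1 i) //= lerD2l.
  rewrite [X in - X](bigD1 i) //= opprD -sumrN.
  apply: (@le_trans _ _ (\sum_(j < N | j != i) - (2 * (c * (th * S))))).
    by rewrite gerDr; lra.
  apply: ler_sum => i' ne.
  have h1 := Di' i' ne.
  have := ler_wpM2l (yge0 i') h1; apply: le_trans.
  by rewrite mulrN lerN2 ler_wpM2r ?yle.
rewrite sumr_const card_ord -[_ *+ N]mulr_natl => h.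
have h2 := ler_wpM2l (yge0 i) Di.
have : c * (- (y i * e)) <= c * (2 * N%:R * (th * S)) by lra.
rewrite ler_pM2l // => h3.
have X0 : 0 <= N%:R * (th * S) :> R by rewrite mulr_ge0 // mulr_ge0.
have [e0|e0] := lerP 0 e; first by apply: le_trans e0; rewrite oppr_le0; lra.
have : y i * e <= 2^-1 * e by rewrite ler_wnM2r ?yge // ltW.
lra.
Qed.

End Vertices.

(** The constant K does not depend on eps, since near_polytope chooses eps in terms
    of K. *)
Lemma polytope_approximation : exists K : R, exists2 lam : R, 0 < lam &
  forall eps, 0 < eps -> exists k (y : 'rV[R]_d -> R),
  [/\ (0 < k)%N, forall v, vert (polyset q) v -> 0 < y v,
      forall x, polyset q x -> 0 <= p_zero (polyset q) q k y (fun=> lam) x &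
      forall x, 0 <= p_zero (polyset q) q k y (fun=> lam) x ->
        [/\ forall j, - eps <= q j x, forall j, `|q j x| <= K &
            forall v, vert (polyset q) v ->
              - (eps * \sum_j `|q j x - q j v|) <= \sum_(j in active q v) q j x]].
Proof.
have [N [vt [vt_inj vtP vt_surj sumE]]] := vertex_enum.
have [lam lam0 lamq] := vertex_scale vt.
have [theta theta01 thetaP] := vertex_contraction vt_inj vtP lam0 lamq.
have /andP[t0 t1] := theta01.
pose D : R := (2 * d)%:R.
have D1 : 1 <= D by rewrite ler1n muln_gt0.
exists ((1 + D) / lam), lam => // eps eps0.
have [k [k0 kth keps]] : exists k, [/\ (0 < k)%N,
    4 * N%:R * theta ^+ (2 * k).-1 <= Num.min eps 1 & D <= (2 * k)%:R * (lam * eps)].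
  pose delta := Num.min eps 1 / (4 * N%:R + 1).
  have N1 : 0 < 4 * N%:R + 1 :> R by rewrite ltr_wpDl // mulr_ge0.
  have delta0 : 0 < delta by rewrite divr_gt0 // lt_min eps0 ltr01.
  have /cvgr0Pnorm_lt/(_ _ delta0)[n0 _ Hn0] :
      (GRing.exp theta : R ^nat) x @[x --> \oo] --> (0 : R).
    by apply: cvg_expr; rewrite ger0_norm.
  exists (n0 + (Num.trunc (D / (lam * eps))).+1)%N; split.
  - by rewrite addnS.
  - set n := (2 * _).-1; have nn0 : (n0 <= n)%N.
      rewrite /n; move: (Num.trunc _) => T; clear; lia.
    have := Hn0 n nn0; rewrite /= ger0_norm ?exprn_ge0 // => /ltW.
    rewrite /delta ler_pdivlMr //.
    apply: le_trans; rewrite mulrC ler_wpM2l ?exprn_ge0 //.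
    by rewrite lerDl.
  rewrite -ler_pdivrMr ?mulr_gt0 //; apply/ltW/(lt_le_trans (truncnS_gt _)).
  rewrite ler_nat; move: (Num.trunc _) => T.
  by rewrite mul2n -addnn (leq_trans (leq_addl n0 _)) // leq_addr.
have [y yP] : exists y : 'I_N -> R, forall i',
    \sum_i vertex_mean q k lam (vt i) (vt i') ^+ (2 * k) * y i = 1 /\ 2^-1 <= y i' <= 2.
  apply: (@dominant_solution _ _ (fun i' i => vertex_mean q k lam (vt i) (vt i') ^+ (2 * k))
    (theta ^+ (2 * k).-1)).
  - by move=> i; rewrite mean_on_vertex // expr1n.
  - move=> i i' ne; have g0 := vertex_mean_ge0 q k lam (vt i') (vt i).
    rewrite exprn_ge0 //=; have gt := thetaP k i' i k0 _.
    rewrite eq_sym in ne; have {}gt := gt ne.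
    rewrite -[X in _ ^+ X](prednK (_ : (0 < 2 * k)%N)) ?muln_gt0 // exprS.
    apply: (@le_trans _ _ (1 * theta ^+ (2 * k).-1)); last by rewrite mul1r.
    by rewrite ler_pM ?exprn_ge0 // ?lerXn2r ?nnegrE //; lra.
  - by rewrite exprn_ge0.
  by move: kth; rewrite le_min => /andP[_]; lra.
have ysol i := (yP i).1; have y12 i := (yP i).2.
(* The weights, transported from indices to points; the sum has at most one term. *)
pose Y v := \sum_(i | vt i == v) y i.
have YE i : Y (vt i) = y i.
  by rewrite /Y (big_pred1 i) // => j; rewrite inj_eq.
exists k, Y; have p0E x : p_zero (polyset q) q k Y (fun=> lam) x =
    1 - \sum_i y i * vertex_mean q k lam (vt i) x ^+ (2 * k).
  by rewrite /p_zero sumE; congr (_ - _); apply: eq_bigr => i _; rewrite YE.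
split=> //.
- by move=> v /vt_surj[i ->]; rewrite YE; case/andP: (y12 i) => ? _; lra.
- by move=> x Px; rewrite p0E subr_ge0; apply: potential_le1.
move=> x; rewrite p0E subr_ge0 => fx.
have bnd j : (1 - lam * q j x) ^+ (2 * k) <= D.
  by apply: (potential_bound vt_surj k0 y12).
have pw (b : R) : 1 <= b -> b <= b ^+ (2 * k).
  by move=> b1; rewrite -{1}[b]expr1 ler_weXn2l // muln_gt0.
split=> [j|j|v /vt_surj[i ->]].
- rewrite leNgt; apply/negP => jx.
  have := bnd j; apply/negP; rewrite -ltNge.
  have h0 : 0 < - (lam * q j x) - lam * eps by rewrite -mulrN -mulrBr mulr_gt0 //; lra.
  have le0 : 0 < lam * eps by rewrite mulr_gt0.
  apply: (@lt_le_trans _ _ ((1 + lam * eps) ^+ (2 * k))); last first.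
    by rewrite lerXn2r ?nnegrE //; lra.
  have := bernoulli_tangent k (1 + lam * eps) 1; rewrite !expr1n mulr1; lra.
- have : `|1 - lam * q j x| <= D.
    have [n1|n1] := lerP `|1 - lam * q j x| 1; first exact: le_trans D1.
    apply: (le_trans (pw _ (ltW n1))).
    by rewrite exprM real_normK ?num_real // -exprM.
  rewrite ler_norml => /andP[h1 h2].
  rewrite ler_pdivlMr // mulrC -{1}(gtr0_norm lam0) -normrM ler_norml; apply/andP; split; lra.
have pt : - (4 * N%:R * theta ^+ (2 * k).-1 * \sum_j `|q j x - q j (vt i)|) <=
    \sum_(j in active q (vt i)) q j x.
  by apply: (potential_tangent vtP lam0 lamq theta01 thetaP k0 ysol y12).
apply: le_trans pt.
rewrite lerN2 ler_wpM2r ?sumr_ge0 //.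
by move: kth; rewrite le_min => /andP[].
Qed.

End PolytopeApproximation.

(** * Polynomial functions and their restrictions to lines *)

Section PolynomialFunctions.
Variables (R : realType) (d : nat).
Implicit Types (f g : 'rV[R]_d -> R) (p : mpoly d R).

Definition polyfun f := exists p, forall x, f x = meval (x ord0) p.

Lemma polyfun_cst c : polyfun (fun=> c).
Proof. by exists (mpolyC d c) => x; rewrite mevalC. Qed.

Lemma polyfunD f g : polyfun f -> polyfun g -> polyfun (fun x => f x + g x).
Proof. by move=> [p fp] [r gr]; exists (p + r) => x; rewrite rmorphD /= fp gr. Qed.

Lemma polyfunM f g : polyfun f -> polyfun g -> polyfun (fun x => f x * g x).
Proof. by move=> [p fp] [r gr]; exists (p * r) => x; rewrite rmorphM /= fp gr. Qed.

Lemma polyfunB f g : polyfun f -> polyfun g -> polyfun (fun x => f x - g x).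
Proof. by move=> [p fp] [r gr]; exists (p - r) => x; rewrite rmorphB /= fp gr. Qed.

Lemma polyfunX f n : polyfun f -> polyfun (fun x => f x ^+ n).
Proof. by move=> [p fp]; exists (p ^+ n) => x; rewrite rmorphXn /= fp. Qed.

Lemma polyfun_sum (I : Type) (r : seq I) (D : pred I) (F : I -> 'rV[R]_d -> R) :
  (forall i, polyfun (F i)) -> polyfun (fun x => \sum_(i <- r | D i) F i x).
Proof.
move=> /choice[p Fp]; exists (\sum_(i <- r | D i) p i) => x.
by rewrite rmorph_sum /=; apply: eq_bigr => i _.
Qed.

Lemma polyfun_fsbig (D : set 'rV[R]_d) (F : 'rV[R]_d -> 'rV[R]_d -> R) :
  finite_set D -> (forall v, polyfun (F v)) -> polyfun (fun x => \sum_(v \in D) F v x).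
Proof.
move=> Dfin Fp; under eq_fun do rewrite fsbig_finite //.
exact: polyfun_sum.
Qed.

Lemma polyfun_prod (I : Type) (r : seq I) (D : pred I) (F : I -> 'rV[R]_d -> R) :
  (forall i, polyfun (F i)) -> polyfun (fun x => \prod_(i <- r | D i) F i x).
Proof.
move=> /choice[p Fp]; exists (\prod_(i <- r | D i) p i) => x.
by rewrite rmorph_prod /=; apply: eq_bigr => i _.
Qed.

Lemma polyfun_affine h : affine_fun h -> polyfun h.
Proof.
move=> ha; have -> : h = fun x => h 0 + \sum_i x 0 i * slope h (delta_mx 0 i).
  by apply/funext => x; apply: affine_coef.
apply: polyfunD; first exact: polyfun_cst.
apply: polyfun_sum => i; apply: polyfunM; last exact: polyfun_cst.
by exists (mpolyX R (mnm1 i)) => x; rewrite mevalXU.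
Qed.

Lemma meval_line p (a b : 'rV[R]_d) :
  exists P : {poly R}, forall t, meval ((a + t *: b) ord0) p = P.[t].
Proof.
exists (\sum_(m <- msupp p) (mcoeff m p)%:P * \prod_i ((a 0 i)%:P + b 0 i *: 'X) ^+ m i).
move=> t; rewrite mevalE horner_sum; apply: eq_bigr => m _.
rewrite hornerM hornerC horner_prod; congr (_ * _); apply: eq_bigr => i _.
by rewrite horner_exp hornerD hornerC hornerZ hornerX !mxE mulrC.
Qed.

End PolynomialFunctions.

Section NearZero.
Variable R : realType.

Lemma near_horner_gt0 (P : {poly R}) : 0 < P.[0] -> \forall t \near 0^'+, 0 < P.[t].
Proof.
move=> P0; have C0 : P.[x] @[x --> (0 : R)] --> P.[0] by exact: continuous_horner.
exact: (cvgr_gt P.[0] (cvg_at_right_filter C0)).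
Qed.

Lemma near_horner_neq0 (P : {poly R}) : P != 0 -> \forall t \near 0^'+, P.[t] != 0.
Proof.
move=> P0; have [n [Q Q0 PE]] := multiplicity_XsubC P 0.
rewrite P0 /= in Q0.
have Q2 : 0 < (Q ^+ 2).[0].
  by rewrite horner_exp exprn_even_gt0 //= -rootE.
near=> t.
have t0 : 0 < t by near: t; exact: nbhs_right_gt.
rewrite PE hornerM subr0 horner_exp hornerX mulf_neq0 ?expf_neq0 ?(gt_eqF t0) //.
have : 0 < (Q ^+ 2).[t] by near: t; exact: near_horner_gt0.
by rewrite horner_exp; apply: contraTneq => ->; rewrite expr0n /= ltxx.
Unshelve. all: by end_near. Qed.

Lemma near_all_seq (T : eqType) (s : seq T) (Q : T -> R -> Prop) :
  (forall p, p \in s -> \forall t \near 0^'+, Q p t) ->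
  \forall t \near 0^'+, forall p, p \in s -> Q p t.
Proof.
elim: s => [|p s IH] H; first by near=> t.
have Hp := H p (mem_head _ _).
have Hs : \forall t \near 0^'+, forall p, p \in s -> Q p t.
  by apply: IH => r rs; apply: H; rewrite inE rs orbT.
near=> t => r; rewrite inE => /orP[/eqP ->|]; first by near: t.
by move: r; near: t.
Unshelve. all: by end_near. Qed.

(** On the line joining two points of L the polynomials become univariate, and
    finitely many nonzero univariate polynomials have common nonroots. *)
Lemma common_nonzero (d : nat) (s : seq (mpoly d R)) (L : set 'rV[R]_d) :
  L !=set0 -> (forall a b t, L a -> L b -> L (a + t *: (b - a))) ->
  (forall p, p \in s -> exists2 x, L x & meval (x ord0) p != 0) ->
  exists2 x, L x & forall p, p \in s -> meval (x ord0) p != 0.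
Proof.
move=> L0 Lline; elim: s => [|p s IH] H; first by have [x Lx] := L0; exists x.
have [r rs|a La sa] := IH; first by apply: H; rewrite inE rs orbT.
have [b Lb pb] := H p (mem_head _ _).
have hs : \forall t \near 0^'+, forall r, r \in s -> meval ((a + t *: (b - a)) ord0) r != 0.
  apply: near_all_seq => r rs; have [P PE] := meval_line r a (b - a).
  have : \forall t \near 0^'+, P.[t] != 0.
    apply: near_horner_neq0; apply: contraNneq (sa r rs) => P0.
    by have := PE 0; rewrite scale0r addr0 P0 horner0 => ->.
  by apply: filterS => t; rewrite PE.
have hp : \forall t \near 0^'+, meval ((a + t *: (b - a)) ord0) p != 0.
  have [P PE] := meval_line p a (b - a).
  have : \forall t \near 0^'+, P.[t] != 0.
    apply: near_horner_neq0; apply: contraNneq pb => P0.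
    by have := PE 1; rewrite scale1r addrC subrK P0 horner0 => ->.
  by apply: filterS => t; rewrite PE.
have [t [ht1 ht2]] := filter_ex (filterI hs hp).
exists (a + t *: (b - a)) => [|r]; first exact: Lline.
by rewrite inE => /orP[/eqP ->|/ht1].
Qed.

End NearZero.

(** * The lower bound *)

Section LowerBound.
Variables (R : realType) (d m : nat) (q : 'I_m -> 'rV[R]_d -> R).
Hypotheses (d0 : (0 < d)%N) (qaff : forall j, affine_fun (q j)).
Hypotheses (simpleP : simple_polytope (polyset q)) (Pm : (facets (polyset q) #= `I_m)%card).

Lemma near_affine_gt0 (h : 'rV[R]_d -> R) (z u : 'rV[R]_d) : affine_fun h -> 0 < h z ->
  \forall t \near 0^'+, 0 < h (z + t *: u).
Proof.
move=> ha hz; have H : \forall t \near 0^'+, 0 < ((h z)%:P + slope h u *: 'X).[t].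
  by apply: near_horner_gt0; rewrite hornerD hornerC hornerZ hornerX mulr0 addr0.
by apply: filterS H => t; rewrite hornerD hornerC hornerZ hornerX affine_ray // mulrC.
Qed.

Section Flag.
Variables (v : 'rV[R]_d) (a : 'I_d -> 'I_m) (E : 'M[R]_d) (A : {fset mpoly d R}).
Hypotheses (vv : vert (polyset q) v) (aP : forall j, j \in active q v <-> exists k, j = a k).
Hypothesis aE : forall k c, slope (q (a k)) (c *m E) = c 0 k.
Hypothesis AP : represents A (polyset q).

(** The flat called L_i above, in the affine coordinates q_(a k) centred at v. *)
Definition flag (i : nat) : set 'rV[R]_d := [set x | forall k : 'I_d, (k < i)%N -> q (a k) x = 0].

(** Suppose the claim fails.  Then every polynomial of the representation either
    vanishes on the larger flat or is in the list s of those that do not vanish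
    identically on the smaller one.  Near v, in the smaller flat, there is a point z
    of the polytope at which all of s is positive; a short step from z in the
    direction that decreases only the i-th coordinate stays in the larger flat and
    keeps every polynomial nonnegative, although it leaves the polytope. *)
Lemma flag_step (i : 'I_d) : exists p, [/\ p \in A,
  forall x, flag i.+1 x -> meval (x ord0) p = 0 & exists2 x, flag i x & meval (x ord0) p != 0].
Proof.
have [Pv _] := (vertP qaff v).1 vv.
have qav k : q (a k) v = 0.
  by have /aP : exists k', a k = a k' by [exists k]; rewrite inE => /eqP.
apply: contrapT => no.
have lineL n x y t : flag n x -> flag n y -> flag n (x + t *: (y - x)).
  move=> Lx Ly k kn; rewrite affine_ray // affine_sub // Lx // Ly //.
  by rewrite subrr mulr0 addr0.
pose s := [seq p <- enum_fset A | `[< exists2 x, flag i.+1 x & meval (x ord0) p != 0 >]].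
have [||p|w Lw ws] := @common_nonzero R d s (flag i.+1).
- by exists v => k _; apply: qav.
- exact: lineL.
- by rewrite mem_filter => /andP[/asboolP].
(* The direction c leads from v into the relative interior of the face in L_(i+1). *)
pose c := \row_(k < d) ((i < k)%N%:R : R).
have [e e0 He] := pos_stable qaff v (c *m E).
pose b := v + e *: (c *m E).
have bk k : q (a k) b = e * (i < k)%N%:R by rewrite affine_ray // qav aE mxE add0r.
have Lb : flag i.+1 b by move=> k; rewrite bk ltnS leqNgt => /negPf ->; rewrite mulr0.
have hs : \forall t \near 0^'+, forall p, p \in s -> meval ((b + t *: (w - b)) ord0) p != 0.
  apply: near_all_seq => p ps; have [P PE] := meval_line p b (w - b).
  have : \forall t \near 0^'+, P.[t] != 0.
    apply: near_horner_neq0; apply: contraNneq (ws p ps) => P0.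
    by have := PE 1; rewrite scale1r addrC subrK P0 horner0 => ->.
  by apply: filterS => t; rewrite PE.
have hq : \forall t \near 0^'+, forall j, j \in enum 'I_m -> 0 <= q j (b + t *: (w - b)).
  apply: near_all_seq => j _.
  have pos : 0 < q j b -> \forall t \near 0^'+, 0 <= q j (b + t *: (w - b)).
    by move=> jb; apply: filterS (near_affine_gt0 (w - b) (qaff j) jb) => t /ltW.
  have [jv|jv] := boolP (j \in active q v); last first.
    by apply: pos; apply: He; [rewrite gtr0_norm|exact: active_pos].
  have [k jk] := (aP j).1 jv; have [ik|ki] := ltnP i k.
    by apply: pos; rewrite jk bk ik mulr1.
  near=> t; rewrite jk (_ : q (a k) _ = 0) //.
  by apply: (lineL i.+1) => //; rewrite ltnS.
have [t [ts tq]] := filter_ex (filterI hs hq).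
set z := b + t *: (w - b) in ts tq.
have Pz : polyset q z by move=> j; apply: tq; rewrite mem_enum.
have Lz : flag i.+1 z by apply: lineL.
have zs p : p \in s -> 0 < meval (z ord0) p.
  move=> ps; rewrite lt_neqAle eq_sym ts //=.
  by move: Pz; rewrite AP /=; apply; move: ps; rewrite mem_filter => /andP[].
(* Along u the i-th coordinate decreases and the other ones are constant. *)
pose u : 'rV[R]_d := - (delta_mx 0 i *m E).
have hz : \forall t \near 0^'+, forall p, p \in s -> 0 < meval ((z + t *: u) ord0) p.
  apply: near_all_seq => p ps; have [P PE] := meval_line p z u.
  have : \forall t \near 0^'+, 0 < P.[t].
    by apply: near_horner_gt0; rewrite -PE scale0r addr0; apply: zs.
  by apply: filterS => r; rewrite PE.
have [r [rs r0]] := filter_ex (filterI hz (nbhs_right_gt (0 : R))).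
have uk k : q (a k) (z + r *: u) = q (a k) z - r * (k == i)%:R.
  by rewrite affine_ray // slopeN // aE mxE eqxx /= mulrN.
have : polyset q (z + r *: u).
  rewrite AP => p pA; have [ps|ps] := boolP (p \in s); first exact/ltW/rs.
  have p0 x : flag i.+1 x -> meval (x ord0) p = 0.
    move=> Lx; apply/eqP/negPn/negP => px; move: ps; rewrite mem_filter pA andbT => /asboolP.
    by apply; exists x.
  rewrite (_ : meval _ p = 0) //; apply/eqP/negPn/negP => pz; apply: no; exists p; split=> //.
  exists (z + r *: u) => // k ki; rewrite uk Lz; last by rewrite ltnS ltnW.
  by rewrite (_ : (k == i) = false) ?mulr0 ?subr0 //; apply/negbTE; rewrite neq_ltn ki.
move=> /(_ (a i)); rewrite uk eqxx mulr1 Lz // sub0r oppr_ge0 leNgt.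
by move: r0 => /= ->.
Unshelve. all: by end_near. Qed.

End Flag.

(** A polynomial that does not vanish on L_j does not vanish on the larger flats
    L_(i+1) for i < j, so the polynomials found at the d steps differ. *)
Lemma represents_card (A : {fset mpoly d R}) : represents A (polyset q) -> (d <= #|` A|)%N.
Proof.
move=> AP; have [v vv] := exists_active qaff simpleP.
have [_ rv] := (vertP qaff v).1 vv.
have [a [E [_ aP aE _]]] := rigid_frame qaff rv (simple_active d0 qaff simpleP Pm vv).
have [p pP] := choice (flag_step vv aP aE AP).
have pinj : injective p.
  have sep (i j : 'I_d) : (i < j)%N -> p i <> p j.
    move=> ij pij; have [_ pi _] := pP i; have [_ _ [x Lx]] := pP j.
    rewrite -pij pi ?eqxx // => k ki; apply: Lx.
    by apply: leq_trans ij; rewrite ltnS -ltnS.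
  move=> i j pij; apply/val_inj/eqP; case: ltngtP => // ij.
    by case: (sep _ _ ij pij).
  by case: (sep _ _ ij (esym pij)).
rewrite -[leqLHS]card_ord -(size_codom p); apply: uniq_leq_size; first exact/injectiveP.
by move=> _ /codomP[i ->]; have [] := pP i.
Qed.

End LowerBound.

(** * The description by d polynomials *)

Section Representation.
Variables (R : realType) (d m : nat) (q : 'I_m -> 'rV[R]_d -> R).
Hypotheses (d2 : (2 <= d)%N) (qaff : forall j, affine_fun (q j)).
Hypotheses (simpleP : simple_polytope (polyset q)) (Pm : (facets (polyset q) #= `I_m)%card).

Lemma sigma_atE l x : sigma_at q l x = sym_sum (q^~ x) l.
Proof.
rewrite /sigma_at /mesym rmorph_sum; apply: eq_bigr => h _.
by rewrite rmorph_prod; apply: eq_bigr => j _; rewrite /= mevalXU.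
Qed.

Lemma polynomial_description : exists (k : nat) (y : 'rV[R]_d -> R) (lambda : 'I_m -> R),
  [/\ (0 < k)%N, forall v, vert (polyset q) v -> 0 < y v, forall j, 0 < lambda j
    & polyset q = [set x | 0 <= p_zero (polyset q) q k y lambda x /\
                   forall i : nat, (1 <= i <= d - 1)%N -> 0 <= p_sym q i x]].
Proof.
have [K [lam lam0 approx]] := polytope_approximation (ltnW d2) qaff simpleP Pm.
have [eps eps0 near] := near_polytope d2 qaff simpleP Pm K.
have [k [y [k0 y0 inP outP]]] := approx eps eps0.
exists k, y, (fun=> lam); split=> //; apply/seteqP; split=> x.
  move=> Px; split=> [|i _]; first exact: inP.
  by rewrite /p_sym sigma_atE; apply: polyset_sym_ge0.
move=> [/outP[h1 h2 h3] px]; apply: near => // i /px.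
by rewrite /p_sym sigma_atE.
Qed.

Lemma polyfun_p_sym i : polyfun (p_sym q i).
Proof.
rewrite (_ : p_sym q i = fun x => sym_sum (q^~ x) (m - d + i + 1)).
  by apply: polyfun_sum => h; apply: polyfun_prod => j; apply: polyfun_affine.
by apply/funext => x; rewrite /p_sym sigma_atE.
Qed.

Lemma polyfun_p_zero k y lambda : polyfun (p_zero (polyset q) q k y lambda).
Proof.
apply: polyfunB; first exact: polyfun_cst.
apply: polyfun_fsbig => [|v]; first exact: vert_finite.
apply: polyfunM; first exact: polyfun_cst.
apply: polyfunX; apply: polyfunM; first exact: polyfun_cst.
apply: polyfun_sum => j; apply: polyfunX; apply: polyfunB; first exact: polyfun_cst.
by apply: polyfunM; [exact: polyfun_cst|exact: polyfun_affine].
Qed.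

Lemma represents_d : exists A : {fset mpoly d R},
  represents A (polyset q) /\ (#|` A| <= d)%N.
Proof.
have [k [y [lambda [k0 y0 lam0 PE]]]] := polynomial_description.
have [p0 p0E] := polyfun_p_zero k y lambda.
have [p pE] := choice polyfun_p_sym.
exists [fset (if val i == 0%N then p0 else p (val i)) | i in 'I_d]%fset; split; last first.
  by rewrite (leq_trans (leq_imfset_card _ _ _)) // -cardE card_ord.
rewrite /represents [LHS]PE; apply/seteqP; split=> x /=.
  move=> [x0 xi] r /imfsetP[i _ ->].
  case: eqP => [_|/eqP i0]; first by rewrite -p0E.
  by rewrite -pE; apply: xi; rewrite lt0n i0 /= -ltnS subn1 prednK // (ltnW d2).
move=> xA; have xi (i : nat) : (i < d)%N -> 0 <= meval (x ord0) (if i == 0%N then p0 else p i).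
  by move=> id; apply: xA; apply/imfsetP; exists (Ordinal id).
split=> [|i /andP[i1 id]]; first by rewrite p0E; apply: (xi 0%N); rewrite ltnW.
rewrite pE; have := xi i; rewrite gtn_eqF //; apply.
by rewrite -(subnK (ltnW d2)) addn1 ltnS.
Qed.

End Representation.

Theorem theorem1p1 (R : realType) (d : nat) (hd : (2 <= d)%N)
    (P : set 'rV[R]_d) (hP : simple_polytope P) :
  s_min P = d /\
  forall (m : nat) (q : 'I_m -> 'rV[R]_d -> R),
    (facets P #= `I_m)%card ->
    (forall j, affine_fun (q j)) ->
    P = [set x | forall j, 0 <= q j x] ->
    exists (k : nat) (y : 'rV[R]_d -> R) (lambda : 'I_m -> R),
      [/\ (0 < k)%N,
          forall v, vert P v -> 0 < y v,
          forall j, 0 < lambda j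
        & P = [set x | 0 <= p_zero P q k y lambda x /\
                       forall i : nat, (1 <= i <= d - 1)%N ->
                         0 <= p_sym q i x]].
Proof.
split=> [|m q Pm qaff PE]; last first.
  rewrite -/(polyset q) in PE; rewrite PE in hP Pm *.
  exact: polynomial_description.
have [[polyP _ dimP] _] := hP.
have [m [q [qaff PE Pm]]] := facet_rep (ltnW hd) dimP polyP.
rewrite PE in hP Pm *.
have [A [AP Ad]] := represents_d hd qaff hP Pm.
have lower := represents_card (ltnW hd) qaff hP Pm.
have Ad' : #|` A|%fset = d by apply/eqP; rewrite eqn_leq Ad lower.
rewrite /s_min; case: xgetP => [n _ [[B [BP <-]] Bmin]|/(_ d)[]].
  by apply/eqP; rewrite eqn_leq lower // andbT (leq_trans (Bmin _ AP)) // Ad'.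
by split; [exists A|exact: lower].
Qed.
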